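(* Let $\varphi=\frac{1+\sqrt5}{2}$, let $\Gamma_0=\langle(\varphi,0),(1,\varphi+3)\rangle_{\mathbb Z}\subset\mathbb R^2$, and let $R_0$ be the $\mathbb Z^2$-action on $\mathbb R^2/\Gamma_0$ given by $R_0^{\boldsymbol n}(\boldsymbol x)=\boldsymbol x+\boldsymbol n$. The partition $\mathcal P_0$ of $\mathbb R^2/\Gamma_0$ (defined in the context) is a Markov partition for the dynamical system $(\mathbb R^2/\Gamma_0,\mathbb Z^2,R_0)$.
   Context: **Subshifts.** For a finite set $\mathcal A$, $\mathcal A^{\mathbb Z^2}$ carries the product topology and the shift $(\sigma^{\boldsymbol n}(x))_{\boldsymbol m}=x_{\boldsymbol m+\boldsymbol n}$. A subshift is a closed shift-invariant subset. A subshift $X$ is a shift of finite type (SFT) if there is a finite set $\mathcal F$ of patterns (functions $S\to\mathcal A$ with $S\subset\mathbb Z^2$ finite) such that $X$ is the set of $x\in\mathcal A^{\mathbb Z^2}$ such that no $\sigma^{\boldsymbol n}(x)|_S$ ($\boldsymbol n\in\mathbb Z^2$, $S\subset\mathbb Z^2$ finite) belongs to $\mathcal F$. **Symbolic systems.** Let $\mathbf T=\mathbb R^2/\Gamma$ with $\Gamma$ a lattice, and let $R$ be a $\mathbb Z^2$-rotation on $\mathbf T$, i.e. $R^{\boldsymbol n}(\boldsymbol x)=\boldsymbol x+n_1\boldsymbol\alpha+n_2\boldsymbol\beta$. A topological partition of $\mathbf T$ is a finite collection $\mathcal P=\{P_a\}_{a\in\mathcal A}$ of disjoint open sets with $\mathbf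 T=\bigcup_a\overline{P_a}$. A pattern $w\in\mathcal A^S$ ($S\subset\mathbb Z^2$ finite) is allowed if $\bigcap_{\boldsymbol k\in S}R^{-\boldsymbol k}(P_{w_{\boldsymbol k}})\neq\varnothing$. $\mathcal X_{\mathcal P,R}\subseteq\mathcal A^{\mathbb Z^2}$ is the subshift of all configurations all of whose finite patterns are allowed. For $w\in\mathcal X_{\mathcal P,R}$ put $D_n(w)=\bigcap_{\|\boldsymbol k\|\le n}R^{-\boldsymbol k}(P_{w_{\boldsymbol k}})$, where $\|\boldsymbol k\|=|k_1|+|k_2|$. $\mathcal P$ gives a symbolic representation of $(\mathbf T,\mathbb Z^2,R)$ if for every $w\in\mathcal X_{\mathcal P,R}$ the intersection $\bigcap_{n\ge0}\overline{D_n(w)}$ consists of exactly one point. $\mathcal P$ is a Markov partition for $(\mathbf T,\mathbb Z^2,R)$ if it gives a symbolic representation of $(\mathbf T,\mathbb Z^2,R)$ and $\mathcal X_{\mathcal P,R}$ is an SFT. **The partition $\mathcal P_0$.** Write $s=\varphi^{-1}$, $t=\varphi^{-2}$. The rectangle $[0,\varphi)\times[0,\varphi+3)$ is a fundamental domain of $\Gamma_0$. $\mathcal P_0$ is indexed by $\{0,1,\dots,10\}$; the atom of each index is the image in $\mathbb R^2/\Gamma_0$ of the union of the interiors of the following polygons (given by their vertices in cyclic order): - 0: $(0,0),(s,0),(s,1)$; $(s,0),(1,0),(1,1)$; $(1,0),(\varphi,0),(\varphi,1)$. - 1: $(0,0),(s,1),(0,1)$; $(s,0),(1,1),(s,1)$;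 $(1,0),(\varphi,1),(1,1)$. - 2: $(0,2),(s,\varphi+2),(0,\varphi+1)$. - 3: $(1,1),(\varphi,2),(\varphi,\varphi+2),(1,2)$. - 4: $(0,2),(1,\varphi+2),(1,\varphi+3)$. - 5: $(0,\varphi+1),(s,\varphi+2),(1,\varphi+3),(t,\varphi+2),(t,\varphi+3),(0,\varphi+2)$. - 6: $(0,\varphi+2),(t,\varphi+3),(0,\varphi+3)$; $(t,\varphi+2),(1,\varphi+3),(t,\varphi+3)$; $(1,\varphi+2),(\varphi,\varphi+3),(1,\varphi+3)$. - 7: $(0,1),(1,\varphi+2),(0,2)$; $(1,\varphi+1),(\varphi,\varphi+2),(\varphi,\varphi+3),(1,\varphi+2)$. - 8: $(s,1),(\varphi,\varphi+2),(s,2)$. - 9: $(0,1),(s,1),(s,2)$; $(s,1),(1,1),(1,2)$; $(1,1),(\varphi,1),(\varphi,2)$. - 10: $(0,1),(1,\varphi+1),(1,\varphi+2)$. *)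

(* Defs.v *)
From HB Require Import structures.
From mathcomp Require Import all_boot all_order all_algebra finmap.
From mathcomp Require Import generic_quotient ring_quotient.
From mathcomp Require Import all_classical all_reals all_analysis.

Set Implicit Arguments.
Unset Strict Implicit.
Unset Printing Implicit Defensive.

Import Order.TTheory GRing.Theory Num.Theory.
Import numFieldTopology.Exports numFieldNormedType.Exports.

Local Open Scope classical_set_scope.
Local Open Scope ring_scope.
Local Open Scope quotient_scope.

Notation Z2 := (int * int)%type.
Notation pattern A := {fmap Z2 -> A}.
Notation config A := {ptws Z2 -> discrete_topology A}.

Definition l1norm (k : Z2) : nat := (`|k.1| + `|k.2|)%N.

Section Subshifts.
Variable A : finType.

Definition config_shift (n : Z2) (x : config A) : config A :=
  fun m => x (m + n).

Definition config_restrict (x : config A) (S : {fset Z2}) : pattern A :=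
  [fmap k : S => (x (val k) : A)].

Definition is_subshift (X : set (config A)) : Prop :=
  closed X /\ forall n x, X x -> X (config_shift n x).

Definition is_SFT (X : set (config A)) : Prop :=
  is_subshift X /\
  exists2 F : set (pattern A), finite_set F &
    X = [set x | forall (n : Z2) (S : {fset Z2}),
      ~ F (config_restrict (config_shift n x) S)].

End Subshifts.

(* [T n] stands for the homeomorphism of index [n] of a Z^2-action on [M], so
   that the image of a set under the homeomorphism of index [- k] is written as
   its preimage under [T k]. *)
Section SymbolicSystems.
Variables (M : topologicalType) (A : finType).
Variables (P : A -> set M) (T : Z2 -> M -> M).

Definition topological_partition : Prop :=
  [/\ forall a, open (P a),
      forall a b, a != b -> P a `&` P b = set0 &
      \bigcup_a closure (P a) = setT].

Definition allowed (w : pattern A) : Prop :=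
  \bigcap_(k : domf w) (T (val k) @^-1` P (w k)) !=set0.

Definition symbolic_system : set (config A) :=
  [set x | forall (n : Z2) (S : {fset Z2}),
     allowed (config_restrict (config_shift n x) S)].

Definition D_cell (n : nat) (w : config A) : set M :=
  \bigcap_(k in [set k : Z2 | (l1norm k <= n)%N]) (T k @^-1` P (w k)).

Definition symbolic_representation : Prop :=
  forall w, symbolic_system w ->
    exists x, \bigcap_n closure (D_cell n w) = [set x].

Definition Markov_partition : Prop :=
  [/\ topological_partition, symbolic_representation & is_SFT symbolic_system].

End SymbolicSystems.

Section Torus.
Variable R : realType.
Implicit Types u v : R * R.

Definition zspan u v : {pred R * R} :=
  fun x => `[< exists m n : int, x = u *~ m + v *~ n >].

Lemma zspan_zmod_closed u v : zmod_closed (zspan u v).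
Proof.
split=> [|x y /asboolP[m [n ->]] /asboolP[m' [n' ->]]]; apply/asboolP.
  by exists 0, 0; rewrite !mulr0z addr0.
by exists (m - m'), (n - n'); rewrite !mulrzBr opprD addrACA.
Qed.

HB.instance Definition _ u v :=
  GRing.isZmodClosed.Build (R * R)%type (zspan u v) (zspan_zmod_closed u v).

(* [Quotient.quot] is the quotient group; [quotient_topology] is the same type
   with the quotient topology. *)
Local Notation torus_group u v := (Quotient.quot (zspan u v)).
Local Notation torus u v := (quotient_topology (torus_group u v)).

Definition rotation u v (alpha beta : R * R) (n : Z2) (x : torus u v) :
    torus u v :=
  (x : torus_group u v) + \pi_(torus_group u v) (alpha *~ n.1 + beta *~ n.2).

End Torus.

Notation torus u v := (quotient_topology (Quotient.quot (zspan u v))).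

Section Polygons.
Variable R : realType.

Definition polygon_edge (p q : R * R) : set (R * R) :=
  [set x | exists2 t : R, 0 <= t <= 1 &
     x = ((1 - t) * p.1 + t * q.1, (1 - t) * p.2 + t * q.2)].

Definition polygon_boundary (V : seq (R * R)) : set (R * R) :=
  [set x | exists2 e, e \in zip V (rot 1 V) & polygon_edge e.1 e.2 x].

(* The region enclosed by the closed polygonal curve, in the sense of the
   Jordan curve theorem: the points off the curve whose component in the
   complement of the curve is bounded. The polygons need not be convex. *)
Definition polygon_interior (V : seq (R * R)) : set (R * R) :=
  [set x | ~ polygon_boundary V x /\
     bounded_set (connected_component (~` polygon_boundary V) x)].

End Polygons.

Section P0.
Variable R : realType.

Definition phi : R := (1 + Num.sqrt 5) / 2.

Local Notation s := (phi^-1).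
Local Notation t := (phi ^- 2).

Local Notation T0 := (torus (phi, 0) (1, phi + 3)).

Definition R0 (n : Z2) (x : T0) : T0 := rotation (1, 0) (0, 1) n x.

Definition P0_polygons (a : 'I_11) : seq (seq (R * R)) :=
  nth [::] [::
    [:: [:: (0, 0); (s, 0); (s, 1)];
        [:: (s, 0); (1, 0); (1, 1)];
        [:: (1, 0); (phi, 0); (phi, 1)]];
    [:: [:: (0, 0); (s, 1); (0, 1)];
        [:: (s, 0); (1, 1); (s, 1)];
        [:: (1, 0); (phi, 1); (1, 1)]];
    [:: [:: (0, 2); (s, phi + 2); (0, phi + 1)]];
    [:: [:: (1, 1); (phi, 2); (phi, phi + 2); (1, 2)]];
    [:: [:: (0, 2); (1, phi + 2); (1, phi + 3)]];
    [:: [:: (0, phi + 1); (s, phi + 2); (1, phi + 3);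
            (t, phi + 2); (t, phi + 3); (0, phi + 2)]];
    [:: [:: (0, phi + 2); (t, phi + 3); (0, phi + 3)];
        [:: (t, phi + 2); (1, phi + 3); (t, phi + 3)];
        [:: (1, phi + 2); (phi, phi + 3); (1, phi + 3)]];
    [:: [:: (0, 1); (1, phi + 2); (0, 2)];
        [:: (1, phi + 1); (phi, phi + 2);
            (phi, phi + 3); (1, phi + 2)]];
    [:: [:: (s, 1); (phi, phi + 2); (s, 2)]];
    [:: [:: (0, 1); (s, 1); (s, 2)];
        [:: (s, 1); (1, 1); (1, 2)];
        [:: (1, 1); (phi, 1); (phi, 2)]];
    [:: [:: (0, 1); (1, phi + 1); (1, phi + 2)]]] a.

Definition P0 (a : 'I_11) : set T0 :=
  \pi_T0 @`
    (\bigcup_(V in [set` P0_polygons a]) polygon_interior V).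

End P0.

(* Main.v *)
(** Z^2 + Gamma_0 = Z[phi]^2, and every edge of the polygons lies on a line
    f = c with c in Z[phi], where f is one of the four forms x, y, y - phi x,
    y - phi^2 x. That the polygons tile a fundamental domain is a finite
    computation in Z[phi]. Points with equal codings are equal, since the
    orbits are dense and a single triangle, atom 2, separates nearby points.

    For the finite type property, let w be a configuration all of whose windows
    of a large radius N are allowed, say by a point x_n for the window around n.
    The points x_n - n lift to a slowly varying family u_n in R^2 which need not
    be constant. The edges contained in the line f = c are visible from the
    positions n in a strip of Z^2, located by the Galois conjugate of c. Reading
    w along this strip shows that f(u_n) - c keeps a constant sign on it, so w
    determines a sign above(f, c) for each line. Four lines pass through each
    point of Z[phi]^2, their strips meet near a common position, and the four
    signs are consistent there.

    These consistencies at single points suffice. If c1 < c2, u is below c1 on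
    the first strip and above c2 on the second, then following the lines of two
    other forms from one strip to the other and back shows that, for a third
    form, the set of lines having u above them is stable under adding e and
    phi e for some e > 0, hence under adding phi^i e for all i. As the conjugate
    of phi^i e tends to 0, all these lines are seen from a single position,
    which is absurd because phi^i e is unbounded. Hence the signs of each form
    define a cut, the four cuts are the values of the forms at one point, and
    this point realizes w, after a perturbation if it lies on some lines. *)

From HB Require Import structures.
Require Import Defs.
From mathcomp Require Import all_boot all_order all_algebra finmap.
From mathcomp Require Import generic_quotient ring_quotient.
From mathcomp Require Import all_classical all_reals all_analysis.
From mathcomp Require Import ring lra zify.

Set Implicit Arguments.
Unset Strict Implicit.
Unset Printing Implicit Defensive.

Import Order.TTheory GRing.Theory Num.Theory.
Import numFieldTopology.Exports numFieldNormedType.Exports.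

Local Open Scope classical_set_scope.
Local Open Scope ring_scope.

(* The pair (a, b) stands for a + b phi. *)
Notation zphi := (int * int)%type.

(** * The four directions of lines and the arithmetic of Z[phi] *)

Inductive dir := DX | DY | D1 | D2.

Definition dir_nat d := match d with DX => 0 | DY => 1 | D1 => 2 | D2 => 3 end%N.
Definition nat_dir n := match n with 0 => DX | 1 => DY | 2 => D1 | _ => D2 end%N.
Lemma dir_natK : cancel dir_nat nat_dir. Proof. by case. Qed.
HB.instance Definition _ := Equality.copy dir (can_type dir_natK).

(** Multiplication by phi and by phi^-1 = phi - 1, in the basis (1, phi). *)
Definition gphi (c : zphi) : zphi := (c.2, c.1 + c.2).
Definition gphiV (c : zphi) : zphi := (c.2 - c.1, c.1).

Definition formz (d : dir) (z : zphi * zphi) : zphi :=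
  match d with
  | DX => z.1
  | DY => z.2
  | D1 => z.2 - gphi z.1
  | D2 => z.2 - gphi (gphi z.1)
  end.

Section Golden.
Variable R : realType.
Local Notation phi := (phi R).

Lemma phi2 : phi * phi = phi + 1.
Proof.
have h : Num.sqrt 5 * Num.sqrt 5 = 5 :> R by rewrite -expr2 sqr_sqrtr.
rewrite /Defs.phi; lra.
Qed.

Lemma phi_gt1 : 1 < phi.
Proof.
have : 1 < Num.sqrt 5 :> R by rewrite -[X in X < _]sqrtr1 ltr_sqrt; lra.
rewrite /Defs.phi; lra.
Qed.

(** Consecutive Fibonacci quotients, narrow enough for the numerical estimates below. *)
Lemma phi_bounds : 21 / 13 < phi < 34 / 21.
Proof. by have h2 := phi2; have h1 := phi_gt1; apply/andP; split; nra. Qed.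

Lemma phi_gt : 21 / 13 < phi. Proof. by case/andP: phi_bounds. Qed.
Lemma phi_lt : phi < 34 / 21. Proof. by case/andP: phi_bounds. Qed.

Definition gval (c : zphi) : R := c.1%:~R + c.2%:~R * phi.
Definition gconj (c : zphi) : R := c.1%:~R + c.2%:~R * (1 - phi).

Lemma gvalD a b : gval (a + b) = gval a + gval b.
Proof. by rewrite /gval /= !intrD; ring. Qed.
Lemma gvalN a : gval (- a) = - gval a.
Proof. by rewrite /gval /= !intrN; ring. Qed.
Lemma gvalB a b : gval (a - b) = gval a - gval b.
Proof. by rewrite gvalD gvalN. Qed.
Lemma gconjD a b : gconj (a + b) = gconj a + gconj b.
Proof. by rewrite /gconj /= !intrD; ring. Qed.
Lemma gconjN a : gconj (- a) = - gconj a.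
Proof. by rewrite /gconj /= !intrN; ring. Qed.
Lemma gconjB a b : gconj (a - b) = gconj a - gconj b.
Proof. by rewrite gconjD gconjN. Qed.
Lemma gval_phi c : gval (gphi c) = phi * gval c.
Proof. by rewrite /gval /gphi /= intrD; ring: phi2. Qed.
Lemma gval_phiV c : gval (gphiV c) = (phi - 1) * gval c.
Proof. by rewrite /gval /gphiV /= intrB; ring: phi2. Qed.
Lemma gconj_phi c : gconj (gphi c) = (1 - phi) * gconj c.
Proof. by rewrite /gconj /gphi /= intrD; ring: phi2. Qed.
Lemma gconj_phiV c : gconj (gphiV c) = - phi * gconj c.
Proof. by rewrite /gconj /gphiV /= intrB; ring: phi2. Qed.

Definition gE := (gvalB, gvalN, gvalD, gval_phi, gval_phiV).
Definition gconjE := (gconjB, gconjN, gconjD, gconj_phi, gconj_phiV).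

Definition form (d : dir) (p : R * R) : R :=
  match d with
  | DX => p.1
  | DY => p.2
  | D1 => p.2 - phi * p.1
  | D2 => p.2 - phi * (phi * p.1)
  end.
(** The Galois conjugates of the four forms: phi is replaced by 1 - phi. *)
Definition formc (d : dir) (p : R * R) : R :=
  match d with
  | DX => p.1
  | DY => p.2
  | D1 => p.2 - (1 - phi) * p.1
  | D2 => p.2 - (1 - phi) * ((1 - phi) * p.1)
  end.
Definition gval2 (z : zphi * zphi) : R * R := (gval z.1, gval z.2).
Definition gconj2 (z : zphi * zphi) : R * R := (gconj z.1, gconj z.2).

Lemma form_gval d z : form d (gval2 z) = gval (formz d z).
Proof. by case: d; rewrite //= !gE. Qed.
Lemma formc_gconj d z : formc d (gconj2 z) = gconj (formz d z).
Proof. by case: d; rewrite //= !gconjE. Qed.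

Lemma form_comb d (p q : R * R) (k : R) :
  form d (p.1 + k * q.1, p.2 + k * q.2) = form d p + k * form d q.
Proof. by case: d => /=; ring. Qed.

Lemma gphi_iter_val i c : gval (iter i gphi c) = phi ^+ i * gval c.
Proof. by elim: i => [|i IH]; rewrite ?expr0 ?mul1r //= gval_phi IH exprS mulrA. Qed.
Lemma gphi_iter_conj i c : gconj (iter i gphi c) = (1 - phi) ^+ i * gconj c.
Proof. by elim: i => [|i IH]; rewrite ?expr0 ?mul1r //= gconj_phi IH exprS mulrA. Qed.
Lemma gphiV_iter_val i c : gval (iter i gphiV c) = (phi - 1) ^+ i * gval c.
Proof. by elim: i => [|i IH]; rewrite ?expr0 ?mul1r //= gval_phiV IH exprS mulrA. Qed.
Lemma gphiV_iter_conj i c : gconj (iter i gphiV c) = (- phi) ^+ i * gconj c.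
Proof. by elim: i => [|i IH]; rewrite ?expr0 ?mul1r //= gconj_phiV IH exprS mulrA. Qed.

Lemma exp_small (q C e : R) : 0 <= q < 1 -> 0 < e -> exists i, q ^+ i * C < e.
Proof.
move=> /andP[q0 q1] e0.
have h : (q ^+ i * C) @[i --> \oo] --> (0 * C).
  by apply: cvgMl; apply: cvg_expr; rewrite ger0_norm.
rewrite mul0r in h.
have /cvgrPdist_lt /(_ e e0) [N _ /(_ N (leqnn N))] := h.
rewrite /= sub0r normrN => hN; exists N.
by apply: le_lt_trans hN; exact: ler_norm.
Qed.

Lemma exp_large (C : R) : exists i0, forall i, (i0 <= i)%N -> C < phi ^+ i.
Proof.
have [i0 h] : exists i0, (phi - 1) ^+ i0 * (`|C| + 1) < 1.
  by apply: exp_small; have := phi_gt; have := phi_lt; lra.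
exists i0 => i hi.
have h1 : (phi * (phi - 1)) ^+ i0 = 1 by rewrite mulrBr phi2 mulr1 addrAC subrr add0r expr1n.
have : 0 < phi ^+ i0 by apply: exprn_gt0; have := phi_gt1; lra.
rewrite exprMn in h1.
have : phi ^+ i0 <= phi ^+ i by apply: ler_weXn2l => //; exact/ltW/phi_gt1.
have := ler_norm C; nra.
Qed.

Lemma conj_exp_small (C e : R) : 0 < e ->
  exists i0, forall i, (i0 <= i)%N -> `|(1 - phi) ^+ i * C| < e.
Proof.
move=> e0; have hq : 0 <= phi - 1 < 1 by have := phi_gt; have := phi_lt; lra.
have [i0 h] := exp_small `|C| hq e0.
exists i0 => i hi; have hn : `|1 - phi| = phi - 1 by rewrite distrC ger0_norm//; case/andP: hq.
rewrite normrM normrX hn; apply: le_lt_trans h; apply: ler_wpM2r => //.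
by apply: ler_wiXn2l => //; case/andP: hq => // _ /ltW.
Qed.

(** If c has value 0, so does phi^i c, while its conjugate tends to 0. An element (a, b) of value 0
    has conjugate -b (2 phi - 1) with 2 phi - 1 > 1, so once the conjugate is below 1 the element
    vanishes; multiplication by phi is then undone. *)
Lemma gval_inj : injective gval.
Proof.
suff h0 c : gval c = 0 -> c = 0.
  by move=> a b h; apply/subr0_eq/h0; rewrite gvalB h subrr.
have hcase (b : zphi) : gval b = 0 -> `|gconj b| < 1 -> b = 0.
  case: b => a b h h1.
  have hb : b = 0.
    have h2 : `|b%:~R * (2 * phi - 1)| < 1 :> R.
      rewrite -normrN; suff -> : - (b%:~R * (2 * phi - 1)) = gconj (a, b) by [].
      by move: h; rewrite /gval /gconj /=; lra.
    have : `|b%:~R| < 1 :> R.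
      apply: le_lt_trans h2; rewrite normrM ler_peMr// ger0_norm; have := phi_gt; lra.
    by rewrite -intr_norm -[1]/(1%:~R) ltr_int; lia.
  by move: h; rewrite hb /gval /= mul0r addr0 => /eqP; rewrite intr_eq0 => /eqP ->.
move=> h; have [i0 hi] := conj_exp_small (gconj c) ltr01.
have : iter i0 gphi c = 0.
  by apply: hcase; rewrite ?gphi_iter_val ?h ?mulr0// gphi_iter_conj; exact: hi.
elim: i0 {hi h} => //= i IH [h1 h2]; apply: IH.
by move: h2; rewrite h1 addr0; case: (iter i gphi c) h1 => /= a b -> ->.
Qed.

(* Z[phi] is a lattice in R^2 under c |-> (gval c, gconj c). *)
Lemma zphi_cover (p q : R) :
  exists c, `|gval c - p| <= 1 /\ `|gconj c - q| <= 4.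
Proof.
(* Value minus conjugate is b (2 phi - 1), so b is read off p - q; then a corrects the value. *)
set b := Num.floor ((p - q) / (2 * phi - 1)).
set a := Num.floor (p - b%:~R * phi).
exists (a, b); rewrite /gval /gconj /=.
have /andP[hb1 hb2] := floor_itv ((p - q) / (2 * phi - 1)); rewrite -/b intrD in hb1 hb2.
have /andP[ha1 ha2] := floor_itv (p - b%:~R * phi); rewrite -/a intrD in ha1 ha2.
have h5 : 0 < 2 * phi - 1 by have := phi_gt; lra.
rewrite ler_pdivlMr// in hb1; rewrite ltr_pdivrMr// in hb2.
by have := phi_gt; have := phi_lt; rewrite !ler_norml; split; nra.
Qed.

(** Cover the target scaled by phi^i and by its conjugate, then divide by phi^i: the error on the
    value shrinks by the factor phi^-i, and the error on the conjugate grows by phi^i, a bound that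
    does not depend on the target. *)
Lemma zphi_dense (e : R) : 0 < e -> exists2 K, 0 < K & forall p q : R,
  exists c, `|gval c - p| < e /\ `|gconj c - q| <= K.
Proof.
move=> e0.
have [i hi] : exists i, (phi - 1) ^+ i * 1 < e.
  by apply: exp_small => //; have := phi_gt; have := phi_lt; lra.
have hp0 : 0 < phi by have := phi_gt; lra.
exists (phi ^+ i * 4); first by rewrite mulr_gt0// exprn_gt0.
move=> p q; have [c [h1 h2]] := zphi_cover (phi ^+ i * p) ((1 - phi) ^+ i * q).
have e1 : (phi - 1) ^+ i * phi ^+ i = 1.
  by rewrite -exprMn mulrC mulrBr phi2 mulr1 addrAC subrr add0r expr1n.
have e2 : (- phi) ^+ i * (1 - phi) ^+ i = 1.
  by rewrite -exprMn (_ : - phi * (1 - phi) = 1) ?expr1n//; ring: phi2.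
exists (iter i gphiV c); rewrite gphiV_iter_val gphiV_iter_conj; split.
  have -> : p = (phi - 1) ^+ i * (phi ^+ i * p) by rewrite mulrA e1 mul1r.
  rewrite -mulrBr normrM; apply: le_lt_trans hi.
  rewrite ger0_norm; last by apply: exprn_ge0; have := phi_gt; lra.
  by apply: ler_wpM2l => //; apply: exprn_ge0; have := phi_gt; lra.
have -> : q = (- phi) ^+ i * ((1 - phi) ^+ i * q) by rewrite mulrA e2 mul1r.
rewrite -mulrBr normrM normrX normrN (ger0_norm (ltW hp0)).
by apply: ler_wpM2l => //; exact/exprn_ge0/ltW.
Qed.

End Golden.

Lemma zphi_eq (a b : zphi) : a.1 = b.1 -> a.2 = b.2 -> a = b.
Proof. by case: a b => ? ? [? ?] /= -> ->. Qed.

(** * Sign systems on the lines *)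

Section SignSystem.
Variable R : realType.
Local Notation phi := (phi R).
(** [above d c] is the recorded side of the line [form d = c] on which the sought point lies.
    [vertexP] is consistency of the four lines through one vertex, with a witness depending on the
    vertex; [bounded_above] concerns lines of one form with nearby conjugates, which are all seen
    from one position. *)
Variable above : dir -> zphi -> bool.

Hypothesis vertexP : forall z, exists p : R * R, forall d,
  form d p != gval R (formz d z) /\ above d (formz d z) = (gval R (formz d z) < form d p).
Hypothesis aboveP : forall d, exists c, above d c.
Hypothesis belowP : forall d, exists c, ~~ above d c.
Hypothesis bounded_above : forall d c, exists M : R, exists2 k : R, 0 < k &
  forall c', `|gconj R c' - gconj R c| <= k -> above d c' -> gval R c' <= M.

(* Fibonacci: stability under adding e and phi e gives stability under adding
   phi^i e, whose conjugate tends to 0. *)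
Lemma gphi_closed_above r e : 0 < gval R e ->
  (forall c, above r c -> above r (c + e)) ->
  (forall c, above r c -> above r (c + gphi e)) ->
  forall c, ~~ above r c.
Proof.
move=> e0 h1 h2 c; apply/negP => hc.
have hi i : (forall c, above r c -> above r (c + iter i gphi e)) /\
            (forall c, above r c -> above r (c + iter i.+1 gphi e)).
  elim: i => [//|i [IH1 IH2]]; split=> // a /IH1/IH2.
  have -> // : a + iter i gphi e + iter i.+1 gphi e = a + iter i.+2 gphi e.
  by apply: zphi_eq; rewrite /=; ring.
have [M [k k0 hM]] := bounded_above r c.
have [i1 hi1] := conj_exp_small (gconj R e) k0.
have [i2 hi2] := exp_large ((M - gval R c) / gval R e).
pose i := (i1 + i2)%N.
have := hM (c + iter i gphi e) _ ((hi i).1 _ hc).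
rewrite gconjD gvalD addrAC subrr add0r gphi_iter_conj gphi_iter_val.
move=> /(_ (ltW (hi1 _ (leq_addr _ _)))).
have := hi2 i (leq_addl _ _); rewrite ltr_pdivrMr//; lra.
Qed.

Lemma offsetP z : exists p : R * R, forall d,
  form d p != 0 /\ above d (formz d z) = (0 < form d p).
Proof.
have [p hp] := vertexP z; exists (p.1 + -1 * gval R z.1, p.2 + -1 * gval R z.2) => d.
have [h1 h2] := hp d; have := form_comb d p (gval2 R z) (-1); rewrite /= => ->.
by rewrite form_gval mulN1r subr_eq0 subr_gt0.
Qed.

Section Transfer.
Variables (d r g : dir) (ld lr : R).
Hypothesis formE : forall p, form g p = ld * form d p + lr * form r p.
Variables z1 z2 : zphi * zphi.
Hypothesis eqg : formz g z1 = formz g z2.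
Hypothesis below1 : ~~ above d (formz d z1).
Hypothesis above2 : above d (formz d z2).

(** z1 and z2 lie on one g-line, so their offsets p and q have the same g-sign. At p both terms of
    [formE] have the sign of lr; at q the d-term has the opposite sign, so the r-term must keep the
    sign of lr. *)
Lemma transfer_opp : ld * lr < 0 -> above r (formz r z1) -> above r (formz r z2).
Proof.
move=> hl; have [p hp] := offsetP z1; have [q hq] := offsetP z2.
have [pd ad] := hp d; have [qd bd] := hq d.
have [pr ar] := hp r; have [qr br] := hq r.
have [pg ag] := hp g; have [qg bg] := hq g.
move: below1 above2; rewrite ad bd ar br => h1 h2 h3.
move: bg; rewrite -eqg ag; move: pd qd pr qr pg qg h1 h2 h3; rewrite !formE.
rewrite !neq_lt -!leNgt.
case: (ltrgt0P ld) => l0; last by move: hl; rewrite l0; lra.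
- have lr0 : lr < 0 by nra.
  move=> pd qd pr qr pg qg h1 h2 h3.
  have {}h1 : form d p < 0 by lra.
  have -> : (0 < ld * form d p + lr * form r p) = false by apply/negbTE; rewrite -leNgt; nra.
  by move=> /esym/negbT; rewrite -leNgt => hh; nra.
- have lr0 : 0 < lr by nra.
  move=> pd qd pr qr pg qg h1 h2 h3.
  have {}h1 : form d p < 0 by lra.
  have -> : (0 < ld * form d p + lr * form r p) = true by nra.
  by move=> /esym hh; nra.
Qed.

(** Contrapositive of the same argument: if d and r are both negative at the offset p of z1, then g
    has the sign opposite to ld there; at z2, where d is positive, this forces r to be negative. *)
Lemma transfer_same : 0 < ld * lr -> above r (formz r z2) -> above r (formz r z1).
Proof.
move=> hl; apply: contraLR; have [p hp] := offsetP z1; have [q hq] := offsetP z2.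
have [pd ad] := hp d; have [qd bd] := hq d.
have [pr ar] := hp r; have [qr br] := hq r.
have [pg ag] := hp g; have [qg bg] := hq g.
move: below1 above2; rewrite ad bd ar br => h1 h2 h3.
move: bg; rewrite -eqg ag; move: pd qd pr qr pg qg h1 h2 h3; rewrite !formE.
rewrite !neq_lt -!leNgt.
case: (ltrgt0P ld) => l0; last by move: hl; rewrite l0; lra.
- have lr0 : 0 < lr by nra.
  move=> pd qd pr qr pg qg h1 h2 h3.
  have {}h1 : form d p < 0 by lra.
  have {}h3 : form r p < 0 by lra.
  have -> : (0 < ld * form d p + lr * form r p) = false by apply/negbTE; rewrite -leNgt; nra.
  by move=> /esym/negbT; rewrite -leNgt => hh; nra.
- have lr0 : lr < 0 by nra.
  move=> pd qd pr qr pg qg h1 h2 h3.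
  have {}h1 : form d p < 0 by lra.
  have {}h3 : form r p < 0 by lra.
  have -> : (0 < ld * form d p + lr * form r p) = true by nra.
  by move=> /esym hh; nra.
Qed.
End Transfer.

(* The two inconsistent lines are joined by lines of two other forms; e is
   chosen so that these realize the translations by e and phi e. *)
Lemma above_mono d c1 c2 : gval R c1 < gval R c2 -> above d c2 -> above d c1.
Proof.
move=> hc h2; apply: contraT => h1.
have hphi1 := phi_gt R; have hphi2 := phi_lt R; have hphi := phi2 R.
have D0 : 0 < gval R (c2 - c1) by rewrite gvalB subr_gt0.
pose D := c2 - c1.
have fin r e : 0 < gval R e ->
  (forall c, above r c -> above r (c + e)) ->
  (forall c, above r c -> above r (c + gphi e)) -> False.
  move=> e0 k1 k2; have [c hcr] := aboveP r.
  by have := gphi_closed_above e0 k1 k2 c; rewrite hcr.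
(* With D = c2 - c1, the r-lines are shifted by e along g and by phi e along g'. The choices of (d;
   r; g, g'; e) are (DX; DY; D1, D2; phi D), (DY; DX; D2, D1; phi^-2 D), (D1; DX; DY, D2; phi^-1 D)
   and (D2; D1; DY, DX; phi^-1 D). *)
case: d h1 h2 => h1 h2; exfalso.
- apply: (fin DY (gphi D)) => [|c hc'|c hc']; first by rewrite gval_phi; nra.
  + have := @transfer_opp DX DY D1 (- phi) 1 _ (c1, c) (c2, c + gphi D); apply => //.
    * by move=> p /=; ring.
    * by apply: zphi_eq; rewrite /= /D; ring.
    * by nra.
  + have := @transfer_opp DX DY D2 (- phi * phi) 1 _ (c1, c) (c2, c + gphi (gphi D)); apply => //.
    * by move=> p /=; ring.
    * by apply: zphi_eq; rewrite /= /D; ring.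
    * by nra.
- apply: (fin DX (gphiV (gphiV D))) => [|c hc'|c hc'].
  + by rewrite !gval_phiV; nra.
  + have := @transfer_opp DY DX D2 1 (- phi * phi) _ (c, c1) (c + gphiV (gphiV D), c2); apply => //.
    * by move=> p /=; ring.
    * by apply: zphi_eq; rewrite /= /D; ring.
    * by nra.
  + have := @transfer_opp DY DX D1 1 (- phi) _ (c, c1) (c + gphi (gphiV (gphiV D)), c2); apply => //.
    * by move=> p /=; ring.
    * by apply: zphi_eq; rewrite /= /D; ring.
    * by nra.
- apply: (fin DX (gphiV D)) => [|c hc'|c hc'].
  + by rewrite !gval_phiV; nra.
  + have := @transfer_same D1 DX DY 1 phi _ (c + gphiV D, c1 + gphi (c + gphiV D)) (c, c2 + gphi c); apply => //.
    * by move=> p /=; ring.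
    * by apply: zphi_eq; rewrite /= /D; ring.
    * by rewrite /= addrK.
    * by rewrite /= addrK.
    * by nra.
  + have := @transfer_opp D1 DX D2 1 (- 1) _ (c, c1 + gphi c) (c + gphi (gphiV D), c2 + gphi (c + gphi (gphiV D))); apply => //.
    * by move=> p /=; ring: (phi2 R).
    * by apply: zphi_eq; rewrite /= /D; ring.
    * by rewrite /= addrK.
    * by rewrite /= addrK.
- apply: (fin D1 (gphiV D)) => [|c hc'|c hc'].
  + by rewrite !gval_phiV; nra.
  + have := @transfer_opp D2 D1 DY (- phi) (phi * phi) _ 
      (c - c1, c + gphi (c - c1)) (c + gphiV D - c2, c + gphiV D + gphi (c + gphiV D - c2)).
    rewrite /= !addrK; apply => //.
    * by move=> p /=; ring: (phi2 R).
    * by apply: zphi_eq; rewrite /= /D; ring.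
    * by move: h1; congr (~~ above _ _); apply: zphi_eq; rewrite /= /D; ring.
    * by move: h2; congr (is_true (above _ _)); apply: zphi_eq; rewrite /= /D; ring.
    * by rewrite hphi mulrDr !mulNr hphi; lra.
  + have := @transfer_opp D2 D1 DX (- 1) 1 _ 
      (c - c1, c + gphi (c - c1)) (c + gphi (gphiV D) - c2, c + gphi (gphiV D) + gphi (c + gphi (gphiV D) - c2)).
    rewrite /= !addrK; apply => //.
    * by move=> p /=; ring: (phi2 R).
    * by apply: zphi_eq; rewrite /= /D; ring.
    * by move: h1; congr (~~ above _ _); apply: zphi_eq; rewrite /= /D; ring.
    * by move: h2; congr (is_true (above _ _)); apply: zphi_eq; rewrite /= /D; ring.
Qed.

(** * The cuts and the point they define *)

Lemma above_sup d : has_sup [set gval R c | c in [set c | above d c]].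
Proof.
have [c hc] := aboveP d; have [c0 hc0] := belowP d; split.
  by exists (gval R c), c.
exists (gval R c0) => _ [c' hc' <-]; rewrite leNgt; apply/negP => h.
by move: hc0; rewrite (above_mono h hc').
Qed.

Definition cut d : R := sup [set gval R c | c in [set c | above d c]].

Lemma lt_cut d c : gval R c < cut d -> above d c.
Proof.
move=> h; have e0 : 0 < cut d - gval R c by rewrite subr_gt0.
have [_ [c' hc' <-]] := sup_adherent e0 (above_sup d).
by rewrite -/(cut d) opprB addrCA subrr addr0 => /above_mono; exact.
Qed.

Lemma gt_cut d c : cut d < gval R c -> ~~ above d c.
Proof.
move=> h; apply/negP => hc; move: h; apply/negP; rewrite -leNgt.
by apply: ub_le_sup; [case: (above_sup d) | exists c].
Qed.

Definition cut_point : R * R := (cut DX, cut DY).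

(** If the cuts violated the linear relation, density would give a vertex whose x-, y- and g-lines
    lie on known sides of their cuts, and these three signs would contradict the relation at the
    witness of that vertex. *)
Lemma cut_lin g k : 0 < k < 3 -> (forall p, form g p = form DY p - k * form DX p) ->
  cut DY - k * cut DX = cut g.
Proof.
move=> hk hg; have hz z : gval R (formz g z) = gval R z.2 - k * gval R z.1.
  by rewrite -form_gval hg.
apply/eqP; rewrite eq_le; apply/andP; split; rewrite leNgt; apply/negP => h.
(* The coordinates of the vertex are within 2e of the cuts and k < 3, so the value of g there is off
   by less than 2e + 3 * 2e = 8e. *)
- pose e := (cut DY - k * cut DX - cut g) / 8.
  have eE : 8 * e = cut DY - k * cut DX - cut g by rewrite /e; field.
  have e0 : 0 < e by lra.
  have [K K0 hK] := zphi_dense e0.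
  have [cx [hx _]] := hK (cut DX + e) 0; have [cy [hy _]] := hK (cut DY - e) 0.
  rewrite !ltr_norml in hx hy.
  have ax : ~~ above DX cx by apply: gt_cut; lra.
  have ay : above DY cy by apply: lt_cut; lra.
  have ag : ~~ above g (formz g (cx, cy)) by apply: gt_cut; rewrite hz /=; nra.
  have [p hp] := offsetP (cx, cy).
  have [px hx'] := hp DX; have [py hy'] := hp DY; have [pg hg'] := hp g.
  rewrite /= in px hx' hy'; rewrite hx' -leNgt in ax; rewrite hy' in ay.
  by rewrite hg' hg /= -leNgt in ag; nra.
- pose e := (cut g - (cut DY - k * cut DX)) / 8.
  have eE : 8 * e = cut g - (cut DY - k * cut DX) by rewrite /e; field.
  have e0 : 0 < e by lra.
  have [K K0 hK] := zphi_dense e0.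
  have [cx [hx _]] := hK (cut DX - e) 0; have [cy [hy _]] := hK (cut DY + e) 0.
  rewrite !ltr_norml in hx hy.
  have ax : above DX cx by apply: lt_cut; lra.
  have ay : ~~ above DY cy by apply: gt_cut; lra.
  have ag : above g (formz g (cx, cy)) by apply: lt_cut; rewrite hz /=; nra.
  have [p hp] := offsetP (cx, cy).
  have [px hx'] := hp DX; have [py hy'] := hp DY; have [pg hg'] := hp g.
  rewrite /= in py hx' hy'; rewrite hx' in ax; rewrite hy' -leNgt in ay.
  by rewrite hg' hg /= in ag; nra.
Qed.

Lemma form_cut_point d : form d cut_point = cut d.
Proof.
have hphi1 := phi_gt R; have hphi2 := phi_lt R; have hphi := phi2 R.
case: d => //=; first by apply: cut_lin => //; lra.
by rewrite mulrA; apply: (@cut_lin D2) => [|p /=]; [rewrite hphi; lra|ring].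
Qed.

(** The determinant of any two of the forms is a unit of Z[phi] up to sign (1, phi or phi^2), so two
    lines over Z[phi] in different directions meet in Z[phi]^2. *)
Lemma cut_point_vertex d e c c' : d <> e ->
  form d cut_point = gval R c -> form e cut_point = gval R c' ->
  exists z, gval2 R z = cut_point.
Proof.
have hphi := phi2 R.
rewrite /gval2; case: cut_point => x y.
move=> hde h1 h2; wlog hlt : d e c c' hde h1 h2 / (dir_nat d < dir_nat e)%N.
  move=> h; case: (ltngtP (dir_nat d) (dir_nat e)) => [|hlt|].
  - exact: (h d e c c').
  - by apply: (h e d c' c) => //; apply: nesym.
  - by case: (d) (e) hde => [] [].
case: d e hde h1 h2 hlt => [] [] // _ /= h1 h2 _; first by exists (c, c'); rewrite h1 h2.
- exists (c, c' + gphi c); rewrite /= !gE -h2 -h1; congr pair; ring.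
- exists (c, c' + gphi (gphi c)); rewrite /= !gE -h2 -h1; congr pair; ring.
- exists (gphiV (c - c'), c); rewrite /= !gE -h2 -h1; congr pair; ring: hphi.
- exists (gphiV (gphiV (c - c')), c); rewrite /= !gE -h2 -h1; congr pair; ring: hphi.
- exists (c - c', c + gphi (c - c')); rewrite /= !gE -h2 -h1; congr pair; ring: hphi.
Qed.

(** The direction in which to leave the lines through the cut point. At a vertex, [vertexP] provides
    it; on a single line, a transversal vector of the recorded sign does; off all lines any vector
    serves. *)
Lemma cut_direction : exists r : R * R, forall d c, form d cut_point = gval R c ->
  form d r != 0 /\ above d c = (0 < form d r).
Proof.
have [[z hz]|nz] := pselect (exists z, gval2 R z = cut_point).
  have [p hp] := offsetP z; exists p => d c; rewrite -hz form_gval => /gval_inj <-.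
  exact: hp.
have [[d [c hdc]]|nd] := pselect (exists d c, form d cut_point = gval R c); last first.
  by exists (0, 0) => d c hdc; exfalso; apply: nd; exists d, c.
have [r hr] : exists r : R * R, form d r = 1.
  by case: (d); [exists (1, 0)|exists (0, 1)|exists (0, 1)|exists (0, 1)]; rewrite //= ?mulr0 subr0.
pose k : R := if above d c then 1 else -1.
exists (0 + k * r.1, 0 + k * r.2) => e c' hec.
have de : e = d.
  apply: contrapT => ned; apply: nz.
  exact: (@cut_point_vertex e d c' c).
have := form_comb e (0, 0) r k; rewrite /= => ->.
have -> : form e (0, 0) = 0 :> R by case: (e) => //=; ring.
move: hec; rewrite de hdc => /gval_inj <-; rewrite hr mulr1 add0r /k.
by case: ifP => _; rewrite ?oppr_eq0 oner_neq0 ?ltr01 ?oppr_gt0 ?ltr10.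
Qed.

(** Move the cut point slightly along the direction of [cut_direction]. Lines through the cut point
    then get the recorded sign, and each of the finitely many other lines in L keeps the side given
    by its cut. *)
Lemma sign_realized (L : seq (dir * zphi)) : exists p : R * R, forall dc, dc \in L ->
  form dc.1 p != gval R dc.2 /\ above dc.1 dc.2 = (gval R dc.2 < form dc.1 p).
Proof.
have [r hr] := cut_direction.
suff [t0 t00 h] : exists2 t0 : R, 0 < t0 & forall dc, dc \in L -> forall t, 0 < t < t0 ->
    let p := (cut_point.1 + t * r.1, cut_point.2 + t * r.2) in
    form dc.1 p != gval R dc.2 /\ above dc.1 dc.2 = (gval R dc.2 < form dc.1 p).
  exists (cut_point.1 + t0 / 2 * r.1, cut_point.2 + t0 / 2 * r.2) => dc hdc.
  by apply: h => //; lra.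
have one d c : exists2 t0 : R, 0 < t0 & forall t, 0 < t < t0 ->
    form d cut_point + t * form d r != gval R c /\ above d c = (gval R c < form d cut_point + t * form d r).
  have q0 : 0 < 1 + `|form d r| by rewrite ltr_pwDl.
  have [hlt|hgt|heq] := ltrgtP (gval R c) (form d cut_point).
  - exists ((form d cut_point - gval R c) / (1 + `|form d r|)).
      by rewrite divr_gt0 ?subr_gt0// ltr_pwDl.
    move=> t /andP[t0]; rewrite (ltr_pdivlMr _ _ q0) => ht.
    have h1 : - form d r <= `|form d r| by rewrite -normrN ler_norm.
    have h2 : gval R c < form d cut_point + t * form d r by nra.
    by rewrite gt_eqF// h2; split=> //; apply: lt_cut; rewrite -form_cut_point.
  - exists ((gval R c - form d cut_point) / (1 + `|form d r|)).
      by rewrite divr_gt0 ?subr_gt0// ltr_pwDl.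
    move=> t /andP[t0]; rewrite (ltr_pdivlMr _ _ q0) => ht.
    have h1 : form d r <= `|form d r| by exact: ler_norm.
    have h2 : form d cut_point + t * form d r < gval R c by nra.
    rewrite lt_eqF// [RHS]ltNge ltW//=; split=> //; apply/negbTE.
    by apply: gt_cut; rewrite -form_cut_point.
  - exists 1 => // t /andP[t0 _]; have [h1 ->] := hr d c (esym heq).
    rewrite -heq -subr_eq0 addrAC subrr add0r (mulf_neq0 (lt0r_neq0 t0) h1).
    by split=> //; rewrite ltrDl (pmulr_rgt0 _ t0).
elim: L => [|[d c] L [t1 t10 h1]]; first by exists 1.
have [t2 t20 h2] := one d c.
exists (Num.min t1 t2); first by rewrite lt_min t10.
move=> dc; rewrite in_cons => /orP[/eqP ->|hdc] t; rewrite lt_min => /and3P[t0 ht1 ht2] /=.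
  by have := form_comb d cut_point r t; rewrite /= => ->; apply: h2; rewrite t0.
by apply: h1 => //; rewrite t0.
Qed.

End SignSystem.

(** * Pseudo-orbits *)

Definition near_index (n m : Z2) : bool := (`|m.1 - n.1| <= 1) && (`|m.2 - n.2| <= 1).

Lemma near_indexD (n m : Z2) : `|m.1 - n.1| <= 1 -> `|m.2 - n.2| <= 1 -> near_index n m.
Proof. by rewrite /near_index => -> ->. Qed.

(* A strip of width 2K is connected under unit steps once each step moves across
   it by at most K: always step towards the middle. *)
Lemma strip_connected (R : realType) (K : R) (h : int -> int -> R) (S : int -> int -> bool) :
  (forall i j, 0 < h (i + 1) j - h i j <= K) ->
  (forall i j, 0 < h i (j + 1) - h i j <= K) ->
  (forall i j, `|h i j| <= K -> `|h (i + 1) j| <= K -> S i j = S (i + 1) j) ->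
  (forall i j, `|h i j| <= K -> `|h i (j + 1)| <= K -> S i j = S i (j + 1)) ->
  forall i j i' j', `|h i j| <= K -> `|h i' j'| <= K -> S i j = S i' j'.
Proof.
move=> h1 h2 S1 S2.
have m1 i i' j : i <= i' -> h i j <= h i' j.
  move=> hi; have [k ->] : exists k : nat, i' = i + k%:Z by exists `|i' - i|%N; lia.
  elim: k => [|k IH]; first by rewrite addr0.
  by apply: le_trans IH _; have /andP[] := h1 (i + k%:Z) j; rewrite -addrA -PoszD addn1; lra.
have m2 i j j' : j <= j' -> h i j <= h i j'.
  move=> hi; have [k ->] : exists k : nat, j' = j + k%:Z by exists `|j' - j|%N; lia.
  elim: k => [|k IH]; first by rewrite addr0.
  by apply: le_trans IH _; have /andP[] := h2 i (j + k%:Z); rewrite -addrA -PoszD addn1; lra.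
(* Induction on the distance. As h increases in both arguments, monotone walks towards the target
   keep h between its end values; if i < i' and j' < j, the sign of h decides between lowering j and
   raising i. *)
suff key (k : nat) i j i' j' : i <= i' -> (`|i' - i| + `|j' - j| <= k)%N ->
    `|h i j| <= K -> `|h i' j'| <= K -> S i j = S i' j'.
  move=> i j i' j' hi hj; have [hii|hii] := leP i i'.
    exact: (key _ _ _ _ _ hii (leqnn _) hi hj).
  by apply/esym; exact: (key _ _ _ _ _ (ltW hii) (leqnn _) hj hi).
elim: k i j i' j' => [|k IH] i j i' j' hi hk; rewrite !ler_norml => /andP[a1 a2] /andP[b1 b2].
  have -> : i' = i by lia.
  by have -> : j' = j by lia.
have up : i < i' -> `|h (i + 1) j| <= K -> S i j = S i' j'.
  move=> hlt hh; rewrite S1 ?ler_norml ?a1// ; last by rewrite -ler_norml.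
  by apply: IH; rewrite ?ler_norml ?b1 -?ler_norml//; clear -hlt hk; lia.
have := h1 i j; move=> /andP[p1 p2].
have [hj|hj] := leP j j'.
  have [e1|n1] := eqVneq i i'.
    have [e2|n2] := eqVneq j j'; first by rewrite e1 e2.
    have hh : `|h i (j + 1)| <= K.
      have /andP[q1 q2] := h2 i j; have q3 : h i (j + 1) <= h i j' by apply: m2; clear -hj n2; lia.
      by rewrite ler_norml; rewrite -e1 in b2; apply/andP; split; lra.
    rewrite S2 ?ler_norml ?a1 -?ler_norml//; apply: IH => //; rewrite ?ler_norml ?b1//; clear -hj n2 hk; lia.
  apply: up; first by clear -hi n1; lia.
  have q3 : h (i + 1) j <= h i' j by apply: m1; clear -hi n1; lia.
  have q4 := m2 i' j j' hj.
  by rewrite ler_norml; apply/andP; split; lra.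
have down : `|h i (j - 1)| <= K -> S i j = S i' j'.
  move=> hh; rewrite -[in LHS](subrK 1 j) -S2 ?subrK ?ler_norml ?a1 -?ler_norml//.
  by apply: IH => //; rewrite ?ler_norml ?b1//; clear -hj hk; lia.
have /andP[q1 q2] := h2 i (j - 1); rewrite subrK in q1 q2.
have [hpos|hneg] := ltP 0 (h i j).
  by apply: down; rewrite ler_norml; apply/andP; split; lra.
have [e1|n1] := eqVneq i i'.
  apply: down; have q3 : h i j' <= h i (j - 1) by apply: m2; clear -hj; lia.
  by rewrite ler_norml; rewrite -e1 in b1; apply/andP; split; lra.
apply: up; first by clear -hi n1; lia.
by rewrite ler_norml; apply/andP; split; lra.
Qed.

Section PseudoOrbit.
Variable R : realType.
Local Notation phi := (phi R).

(** The integer vector congruent to z modulo Gamma_0: translating by z amounts on the torus to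
    moving to the position [nproj z]. *)
Definition nproj (z : zphi * zphi) : Z2 := (z.1.1 - z.2.2, z.2.1 - z.2.2 *+ 3).

(* If p + n = b (phi, 0) + e (1, phi + 3) with real b and e, this is
   (p.1 - sqrt 5 b, p.2 - sqrt 5 e); by [phys_vertex] it extends the Galois
   conjugation to the positions n. *)
Definition phys (p : R * R) (n : Z2) : R * R :=
  (p.1 - (3 - phi) * (p.1 + n.1%:~R) + (13 - 6 * phi) / 11 * (p.2 + n.2%:~R),
   p.2 - (7 * phi - 6) / 11 * (p.2 + n.2%:~R)).

Lemma phys_vertex z : phys (gval2 R z) (- nproj z) = gconj2 R z.
Proof.
rewrite /phys /gval2 /gconj2 /gval /gconj /nproj; case: z => [[a b] [c e]] /=.
by rewrite mulrSr mulr2n !intrN !intrB !intrD; congr pair; field: (phi2 R).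
Qed.

Lemma formc_dist d (p q : R * R) : `|p.1 - q.1| <= 2 -> `|p.2 - q.2| <= 1 ->
  `|formc d p - formc d q| <= 4.
Proof.
have a1 := phi_gt R; have a2 := phi_lt R; rewrite !ler_norml => h1 h2.
case: d => /=; try lra.
- rewrite (_ : _ - _ = (p.2 - q.2) - (1 - phi) * (p.1 - q.1)); first by nra.
  by ring.
- rewrite (_ : _ - _ = (p.2 - q.2) - (2 - phi) * (p.1 - q.1)); first by nra.
  by ring: (phi2 R).
Qed.

(* Signs making the steps (1, -1) and (0, 1) increase [formc d]; the step (1, 0)
   would not do, as it leaves [formc DY] unchanged. *)
Definition step_sign1 d : int := match d with DX => -1 | DY => 1 | D1 => -1 | D2 => 1 end.
Definition step_sign2 d : int := match d with DX => 1 | DY => -1 | D1 => -1 | D2 => -1 end.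

Lemma formc_diff d (p q : R * R) : formc d p - formc d q =
  match d with
  | DX => p.1 - q.1
  | DY => p.2 - q.2
  | D1 => (p.2 - q.2) + (phi - 1) * (p.1 - q.1)
  | D2 => (p.2 - q.2) - (2 - phi) * (p.1 - q.1)
  end.
Proof. by case: d => //=; ring: (phi2 R). Qed.

Lemma formc_step1 d (p q : R * R) :
  `|p.1 - q.1 + (3 - phi) * (step_sign1 d)%:~R - (13 - 6 * phi) / 11 * (- step_sign1 d)%:~R| <= 1 / 100 ->
  `|p.2 - q.2 + (7 * phi - 6) / 11 * (- step_sign1 d)%:~R| <= 1 / 100 ->
  0 < formc d p - formc d q <= 40.
Proof.
have a1 := phi_gt R; have a2 := phi_lt R.
rewrite formc_diff; move: (p.1 - q.1) (p.2 - q.2) => x y; rewrite !ler_norml.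
case: d => /=; rewrite ?intrN ?opprK ?mulrN1 ?mulr1 => h1 h2; try lra.
- have b1 : 16 / 10 < x < 175 / 100 by lra.
  nra.
- have b1 : -(175 / 100) < x < -(16 / 10) by lra.
  nra.
Qed.

Lemma formc_step2 d (p q : R * R) :
  `|p.1 - q.1 + (3 - phi) * 0%:~R - (13 - 6 * phi) / 11 * (step_sign2 d)%:~R| <= 1 / 100 ->
  `|p.2 - q.2 + (7 * phi - 6) / 11 * (step_sign2 d)%:~R| <= 1 / 100 ->
  0 < formc d p - formc d q <= 40.
Proof.
have a1 := phi_gt R; have a2 := phi_lt R.
rewrite formc_diff; move: (p.1 - q.1) (p.2 - q.2) => x y; rewrite !ler_norml.
case: d => /=; rewrite ?intrN ?mulr0 ?mulrN1 ?mulr1 => h1 h2; try lra.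
- have b1 : -(4 / 10) < x < -(2 / 10) by lra.
  nra.
- have b1 : -(4 / 10) < x < -(2 / 10) by lra.
  nra.
Qed.

(** [u n] is the point seen from position n, and [strip d c n] is the signed distance of n from the
    middle of the strip of the line [form d = c]. The line counts as visible from n when this is at
    most 40 in absolute value. *)
Variable u : Z2 -> R * R.
Let Y n := phys (u n) n.
Let strip d c n : R := formc d (Y n) - gconj R c.

Hypothesis slow : forall n m, near_index n m ->
  `|(u m).1 - (u n).1| <= 1 / 100 /\ `|(u m).2 - (u n).2| <= 1 / 100.
Hypothesis side_const : forall d c n m, near_index n m -> `|strip d c n| <= 40 ->
  form d (u n) != gval R c /\ (gval R c < form d (u n)) = (gval R c < form d (u m)).

(** [phys] is affine: a unit step moves it by a fixed linear image of m - n, and the drift of u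
    enters with coefficients small enough to keep the error below 1/100. *)
Lemma Y_step n m : near_index n m ->
  let e1 := (Y m).1 - (Y n).1 + (3 - phi) * (m.1 - n.1)%:~R - (13 - 6 * phi) / 11 * (m.2 - n.2)%:~R in
  let e2 := (Y m).2 - (Y n).2 + (7 * phi - 6) / 11 * (m.2 - n.2)%:~R in
  `|e1| <= 1 / 100 /\ `|e2| <= 1 / 100.
Proof.
move=> /slow[]; rewrite /Y /phys /= !intrB !ler_norml => h1 h2.
have a1 := phi_gt R; have a2 := phi_lt R.
set x := (u m).1 - (u n).1 in h1; set y := (u m).2 - (u n).2 in h2.
split.
- rewrite (_ : _ - _ = (phi - 2) * x + (13 - 6 * phi) / 11 * y); first by nra.
  by rewrite /x /y; ring.
- rewrite (_ : _ + _ = (1 - (7 * phi - 6) / 11) * y); first by nra.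
  by rewrite /y; ring.
Qed.

(** Greedy descent by unit steps: vertical steps bring the second coordinate of [Y] near that of y,
    and horizontal steps, which hardly change it, then bring the first. *)
Lemma phys_surj (y : R * R) : exists n, forall d, `|formc d (Y n) - formc d y| <= 4.
Proof.
have a1 := phi_gt R; have a2 := phi_lt R.
suff [n [h1 h2]] : exists n, `|(Y n).1 - y.1| <= 2 /\ `|(Y n).2 - y.2| <= 1.
  by exists n => d; exact: formc_dist.
(* A vertical step gains at least 0.45 in the second coordinate and loses at most 0.32 in the first,
   so with weight 2 on the second every step gains at least 1/4. *)
suff H (k : nat) n : `|(Y n).1 - y.1| + 2 * `|(Y n).2 - y.2| <= k%:R / 4 ->
    exists n, `|(Y n).1 - y.1| <= 2 /\ `|(Y n).2 - y.2| <= 1.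
  pose B := `|(Y 0).1 - y.1| + 2 * `|(Y 0).2 - y.2|.
  apply: (H (Num.bound (4 * B)) 0); rewrite -/B.
  have : 0 <= 4 * B by rewrite /B mulr_ge0 ?addr_ge0 ?mulr_ge0.
  by move=> /archi_boundP; lra.
elim: k n => [|k IH] n hk.
  by exists n; have := normr_ge0 ((Y n).1 - y.1); have := normr_ge0 ((Y n).2 - y.2); split; lra.
have next m : near_index n m -> `|(Y m).1 - y.1| + 2 * `|(Y m).2 - y.2| <=
    `|(Y n).1 - y.1| + 2 * `|(Y n).2 - y.2| - 1 / 4 ->
    exists n, `|(Y n).1 - y.1| <= 2 /\ `|(Y n).2 - y.2| <= 1.
  by move=> _ hm; apply: (IH m); move: hk; rewrite -natr1; lra.
have tri (a b e : R) : `|a - b| <= e -> `|a| <= `|b| + e.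
  by move=> h; rewrite -[a](subrK b) addrC; apply: le_trans (ler_normD _ _) _; rewrite lerD2l.
have [h2|h2] := leP `|(Y n).2 - y.2| 1; last first.
  have [hs|hs] := leP 0 ((Y n).2 - y.2).
  - have hn : near_index n (n.1, n.2 + 1) by apply: near_indexD; rewrite ?subrr// addrC addKr.
    apply: (next _ hn); have := Y_step hn; move: (Y _) (Y n) h2 hs => p q h2 hs /=.
    rewrite subrr (addrAC n.2) subrr add0r /= mulr0 mulr1 addr0 !ler_norml => -[c1 c2].
    rewrite ger0_norm// in h2.
    have t1 : `|p.1 - y.1| <= `|q.1 - y.1| + 32 / 100 by apply: tri; rewrite ler_norml; lra.
    have t2 : `|p.2 - y.2| <= `|q.2 - y.2| - 45 / 100 by rewrite (ger0_norm hs) ler_norml; lra.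
    lra.
  - have hn : near_index n (n.1, n.2 - 1) by apply: near_indexD; rewrite ?subrr// addrC addKr.
    apply: (next _ hn); have := Y_step hn; move: (Y _) (Y n) h2 hs => p q h2 hs /=.
    rewrite subrr (addrAC n.2) subrr add0r /= intrN mulr0 mulrN1 addr0 !ler_norml => -[c1 c2].
    rewrite ltr0_norm// in h2.
    have t1 : `|p.1 - y.1| <= `|q.1 - y.1| + 32 / 100 by apply: tri; rewrite ler_norml; lra.
    have t2 : `|p.2 - y.2| <= `|q.2 - y.2| - 45 / 100 by rewrite (ltr0_norm hs) ler_norml; lra.
    lra.
have [h1|h1] := leP `|(Y n).1 - y.1| 2; first by exists n.
have [hs|hs] := leP 0 ((Y n).1 - y.1).
- have hn : near_index n (n.1 + 1, n.2) by apply: near_indexD; rewrite ?subrr// addrC addKr.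
  apply: (next _ hn); have := Y_step hn; move: (Y _) (Y n) h1 hs => p q h1 hs /=.
  rewrite subrr (addrAC n.1) subrr add0r /= !mulr0 mulr1 subr0 addr0 !ler_norml => -[c1 c2].
  rewrite ger0_norm// in h1.
  have t1 : `|p.2 - y.2| <= `|q.2 - y.2| + 1 / 100 by apply: tri; rewrite ler_norml; lra.
  have t2 : `|p.1 - y.1| <= `|q.1 - y.1| - 1 by rewrite (ger0_norm hs) ler_norml; lra.
  lra.
- have hn : near_index n (n.1 - 1, n.2) by apply: near_indexD; rewrite ?subrr// addrC addKr.
  apply: (next _ hn); have := Y_step hn; move: (Y _) (Y n) h1 hs => p q h1 hs /=.
  rewrite subrr (addrAC n.1) subrr add0r /= intrN !mulr0 mulrN1 subr0 addr0 !ler_norml => -[c1 c2].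
  rewrite ltr0_norm// in h1.
  have t1 : `|p.2 - y.2| <= `|q.2 - y.2| + 1 / 100 by apply: tri; rewrite ler_norml; lra.
  have t2 : `|p.1 - y.1| <= `|q.1 - y.1| - 1 by rewrite (ltr0_norm hs) ler_norml; lra.
  lra.
Qed.

(** The coordinates N follow the steps (1, -1) and (0, 1) with the signs that make [strip] increase
    by at most 40. The strip is then connected by [strip_connected], and [side_const] carries the
    side along the path. *)
Lemma strip_const d c n m : `|strip d c n| <= 40 -> `|strip d c m| <= 40 ->
  (gval R c < form d (u n)) = (gval R c < form d (u m)).
Proof.
have a1 := phi_gt R; have a2 := phi_lt R.
pose N i j : Z2 := (step_sign1 d * i, step_sign2 d * j - step_sign1 d * i).
have NK k : N (step_sign1 d * k.1) (step_sign2 d * (k.1 + k.2)) = k.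
  by case: k => k1 k2; rewrite /N /=; congr pair; case: (d) => /=; ring.
have near1 i j : near_index (N i j) (N (i + 1) j).
  by apply: near_indexD; clear; rewrite /N /=; case: (d) => /=; lia.
have near2 i j : near_index (N i j) (N i (j + 1)).
  by apply: near_indexD; clear; rewrite /N /=; case: (d) => /=; lia.
rewrite -(NK n) -(NK m); move: (step_sign1 d * n.1) (step_sign2 d * (n.1 + n.2)) (step_sign1 d * m.1) (step_sign2 d * (m.1 + m.2)).
apply: (@strip_connected R 40 (fun i j => strip d c (N i j))
         (fun i j => gval R c < form d (u (N i j)))).
- move=> i j; have [] := Y_step (near1 i j).
  have -> : (N (i + 1) j).1 - (N i j).1 = step_sign1 d by rewrite /N /=; ring.
  have -> : (N (i + 1) j).2 - (N i j).2 = - step_sign1 d by rewrite /N /=; ring.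
  move=> h1 h2; have -> : strip d c (N (i + 1) j) - strip d c (N i j) =
    formc d (Y (N (i + 1) j)) - formc d (Y (N i j)) by rewrite /strip; ring.
  exact: formc_step1.
- move=> i j; have [] := Y_step (near2 i j).
  have -> : (N i (j + 1)).1 - (N i j).1 = 0 by rewrite /N /=; ring.
  have -> : (N i (j + 1)).2 - (N i j).2 = step_sign2 d by rewrite /N /=; ring.
  move=> h1 h2; have -> : strip d c (N i (j + 1)) - strip d c (N i j) =
    formc d (Y (N i (j + 1))) - formc d (Y (N i j)) by rewrite /strip; ring.
  exact: formc_step2.
- by move=> i j hi _; have [_ ->] := side_const (near1 i j) hi.
- by move=> i j hi _; have [_ ->] := side_const (near2 i j) hi.
Qed.

Definition above d c : bool := `[< exists2 n, `|strip d c n| <= 40 & gval R c < form d (u n) >].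

Lemma aboveE d c n : `|strip d c n| <= 40 -> above d c = (gval R c < form d (u n)).
Proof.
move=> hn; apply/idP/idP => [/asboolP[m hm]|h]; first by rewrite (strip_const hn hm).
by apply/asboolP; exists n.
Qed.

Lemma near_refl n : near_index n n.
Proof. by rewrite /near_index !subrr. Qed.

Lemma side_neq d c n : `|strip d c n| <= 40 -> form d (u n) != gval R c.
Proof. by move=> /(side_const (near_refl n))[]. Qed.

(** The hypotheses of [sign_realized]: by [phys_surj] some position n sees all four lines through a
    given vertex, and [u n] is a witness there. Lines at distance about 2 from [u 0], visible from
    position 0, give both signs. Lines with conjugate within 10 of that of c are all seen from one
    n, hence bounded by [form d (u n)]. *)
Lemma pseudo_orbit (L : seq (dir * zphi)) : exists p : R * R, forall dc, dc \in L ->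
  forall n, `|strip dc.1 dc.2 n| <= 40 ->
  form dc.1 p != gval R dc.2 /\ (gval R dc.2 < form dc.1 (u n)) = (gval R dc.2 < form dc.1 p).
Proof.
suff H : exists p : R * R, forall dc, dc \in L ->
    form dc.1 p != gval R dc.2 /\ above dc.1 dc.2 = (gval R dc.2 < form dc.1 p).
  have [p hp] := H; exists p => dc /hp[h1 h2] n hn; split=> //.
  by rewrite -aboveE.
apply: sign_realized.
- move=> z; have [n hn] := phys_surj (gconj2 R z); exists (u n) => d.
  have := hn d; rewrite formc_gconj -/(strip _ _ _) => hs.
  have {}hs : `|strip d (formz d z) n| <= 40 by apply: le_trans hs _; lra.
  by split; [exact: side_neq | exact: aboveE].
- move=> d; have [c [h1 h2]] := zphi_cover (form d (u 0) - 2) (formc d (Y 0)).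
  exists c; rewrite (@aboveE d c 0); first by move: h1; rewrite ler_norml; lra.
  by rewrite /strip distrC; apply: le_trans h2 _; lra.
- move=> d; have [c [h1 h2]] := zphi_cover (form d (u 0) + 2) (formc d (Y 0)).
  exists c; rewrite (@aboveE d c 0); first by move: h1; rewrite ler_norml -leNgt; lra.
  by rewrite /strip distrC; apply: le_trans h2 _; lra.
- move=> d c; have [z hz] : exists z, formz d z = c.
    case: d; [exists (c, 0)|exists (0, c)|exists (0, c)|exists (0, c)] => //=;
      by apply: zphi_eq => /=; ring.
  have [n hn] := phys_surj (gconj2 R z).
  have := hn d; rewrite formc_gconj hz => hs.
  exists (form d (u n)), 10 => // c' hc'; rewrite (@aboveE d c' n); first exact: ltW.
  by move: hs hc'; rewrite /strip !ler_norml; lra.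
Qed.

End PseudoOrbit.

(** * Polygons *)

(** The triple (d, b, c) encodes the open half-plane [form d > c] if b is true and [form d < c]
    otherwise. *)
Definition constr := (dir * bool * zphi)%type.

Definition gmul (a b : zphi) : zphi :=
  (a.1 * b.1 + a.2 * b.2, a.1 * b.2 + a.2 * b.1 + a.2 * b.2).

(* [21/13 < phi < 34/21] *)
Definition gpos (c : zphi) : bool :=
  if 0 <= c.2 then 0 < 13%:Z * c.1 + 21%:Z * c.2 else 0 < 21%:Z * c.1 + 34%:Z * c.2.
Definition gnneg (c : zphi) : bool := (c == 0) || gpos c.

Definition slackz (h : constr) (z : zphi * zphi) : zphi :=
  if h.1.2 then formz h.1.1 z - h.2 else h.2 - formz h.1.1 z.

(* Coefficients of the linear relations between three forms. *)
Definition form_rel (d1 d2 d3 : dir) : option (zphi * zphi * zphi) :=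
  match d1, d2, d3 with
  | DX, DY, D1 => Some ((0, -1), (1, 0), (-1, 0))
  | DX, DY, D2 => Some ((-1, -1), (1, 0), (-1, 0))
  | DX, D1, D2 => Some ((-1, 0), (1, 0), (-1, 0))
  | DY, D1, D2 => Some ((-1, 0), (1, 1), (0, -1))
  | _, _, _ => None
  end.

Definition clash2 (h1 h2 : constr) : bool :=
  [&& h1.1.1 == h2.1.1, h1.1.2, ~~ h2.1.2 & gnneg (h1.2 - h2.2)].

(** A Farkas certificate: when the sides match the signs of the coefficients of the linear relation,
    or are all opposite to them, the combination of the slacks with weights |k1|, |k2|, |k3| is a
    constant, here tested to be nonpositive. *)
Definition clash3 (h1 h2 h3 : constr) : bool :=
  if form_rel h1.1.1 h2.1.1 h3.1.1 is Some (k1, k2, k3) then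
    let c := gmul k1 h1.2 + gmul k2 h2.2 + gmul k3 h3.2 in
    [&& h1.1.2 == gpos k1, h2.1.2 == gpos k2, h3.1.2 == gpos k3 & gnneg c] ||
    [&& h1.1.2 == ~~ gpos k1, h2.1.2 == ~~ gpos k2, h3.1.2 == ~~ gpos k3 & gnneg (- c)]
  else false.

(* By Helly's theorem an empty intersection of open half-planes is already empty
   for two or three of them. *)
Definition infeasible (L : seq constr) : bool :=
  has (fun h1 => has (fun h2 => clash2 h1 h2 || has (clash3 h1 h2) L) L) L.

Definition negc (h : constr) : constr := (h.1.1, ~~ h.1.2, h.2).

(** Keeps one constraint per direction and side, so that the lists in [covers] stay short. *)
Definition tighten (h : constr) (L : seq constr) : seq constr :=
  let same (g : constr) := (g.1.1 == h.1.1) && (g.1.2 == h.1.2) in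
  let stronger (g : constr) := same g && (if h.1.2 then gnneg (g.2 - h.2) else gnneg (h.2 - g.2)) in
  if has stronger L then L else h :: [seq g <- L | ~~ same g].

(* Splits the region [L] along the edges of the first polygon meeting it. *)
Fixpoint covers (L : seq constr) (Qs : seq (seq constr)) : bool :=
  if infeasible L then true else
  if Qs is Q :: Qs' then
    if infeasible (Q ++ L) then covers L Qs' else
    (fix branch L Q := if Q is h :: Q' then
       covers (tighten (negc h) L) Qs' && branch (tighten h L) Q' else true) L Q
  else false.

(** The side is that of a vertex strictly above the edge line, if there is one. The default D2 is
    not tested here; [convex_check] confirms that both ends lie on the line. *)
Definition edge_constr (V : seq (zphi * zphi)) (v w : zphi * zphi) : constr :=
  let d := if v.1 == w.1 then DX else if v.2 == w.2 then DY
           else if formz D1 v == formz D1 w then D1 else D2 in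
  (d, has (fun p => gpos (formz d p - formz d v)) V, formz d v).

Definition edge_constrs V := [seq edge_constr V e.1 e.2 | e <- zip V (rot 1 V)].

(** Each edge has both ends, hence all its points, outside some single half-plane of W, so the
    boundary misses the region W. *)
Definition avoids V (W : seq constr) : bool :=
  all (fun e => has (fun h => gnneg (- slackz h e.1) && gnneg (- slackz h e.2)) W)
    (zip V (rot 1 V)).

(* The last two conditions bound the parameter on each edge by the neighbouring
   edges. *)
Definition convex_check V :=
  let Q := edge_constrs V in
  [&& avoids V Q, all (fun h => avoids V [:: negc h]) Q &
    all (fun e => let h := edge_constr V e.1 e.2 in
      [&& slackz h e.1 == 0, slackz h e.2 == 0,
          has (fun g => (slackz g e.1 == 0) && gpos (slackz g e.2)) Q &
          has (fun g => (slackz g e.2 == 0) && gpos (slackz g e.1)) Q])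
      (zip V (rot 1 V))].

(* In the basis [1, phi]: [phi^-1 = (-1, 1)] and [phi^-2 = (2, -1)]. *)
Definition polygon_data (a : nat) : seq (seq (zphi * zphi)) :=
  let o : zphi := (0, 0) in let i : zphi := (1, 0) in let ii : zphi := (2, 0) in
  let s : zphi := (-1, 1) in let t : zphi := (2, -1) in let p : zphi := (0, 1) in
  let p1 : zphi := (1, 1) in let p2 : zphi := (2, 1) in let p3 : zphi := (3, 1) in
  nth [::] [::
    [:: [:: (o, o); (s, o); (s, i)];
        [:: (s, o); (i, o); (i, i)];
        [:: (i, o); (p, o); (p, i)]];
    [:: [:: (o, o); (s, i); (o, i)];
        [:: (s, o); (i, i); (s, i)];
        [:: (i, o); (p, i); (i, i)]];
    [:: [:: (o, ii); (s, p2); (o, p1)]];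
    [:: [:: (i, i); (p, ii); (p, p2); (i, ii)]];
    [:: [:: (o, ii); (i, p2); (i, p3)]];
    [:: [:: (o, p1); (s, p2); (i, p3); (t, p2); (t, p3); (o, p2)]];
    [:: [:: (o, p2); (t, p3); (o, p3)];
        [:: (t, p2); (i, p3); (t, p3)];
        [:: (i, p2); (p, p3); (i, p3)]];
    [:: [:: (o, i); (i, p2); (o, ii)];
        [:: (i, p1); (p, p2); (p, p3); (i, p2)]];
    [:: [:: (s, i); (p, p2); (s, ii)]];
    [:: [:: (o, i); (s, i); (s, ii)];
        [:: (s, i); (i, i); (i, ii)];
        [:: (i, i); (p, i); (p, ii)]];
    [:: [:: (o, i); (i, p1); (i, p2)]]] a.

(* The hexagon is the only non-convex polygon; it is the union of two overlapping
   convex regions. *)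
Definition hexagon_regions : seq (seq constr) :=
  [:: [:: (DX, true, (0, 0)); (DX, false, (2, -1)); (D1, true, (1, 1)); (D2, false, (2, 1))];
      [:: (DX, true, (0, 0)); (D1, true, (1, 1)); (D2, true, (2, 0)); (D1, false, (3, 0))]].

Definition regions V : seq (seq constr) :=
  if size V == 6 then hexagon_regions else [:: edge_constrs V].

Definition pieces a : seq (seq constr) := flatten [seq regions V | V <- polygon_data a].

Definition box_constrs : seq constr :=
  [:: (DX, true, (0, 0)); (DX, false, (0, 1)); (DY, true, (0, 0)); (DY, false, (3, 1))].

Definition all_pieces := flatten [seq pieces a | a <- iota 0 11].

Lemma polygons_convex :
  all (fun a => 
    all (fun V => (size V == 6) || convex_check V) (polygon_data a)) (iota 0 11).
Proof. by vm_compute. Qed.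

Lemma pieces_in_box : all (fun Q => all (fun h => infeasible (negc h :: Q)) box_constrs) all_pieces.
Proof. by vm_compute. Qed.

Lemma pieces_disjoint : all (fun a => all (fun b => (a == b) ||
  all (fun Q => all (fun Q' => infeasible (Q ++ Q')) (pieces b)) (pieces a)) (iota 0 11)) (iota 0 11).
Proof. by vm_compute. Qed.

Lemma pieces_cover : covers box_constrs all_pieces.
Proof. by vm_compute. Qed.

(** * Soundness of the half-plane tests *)

Section Pieces.
Variable R : realType.
Local Notation phi := (phi R).

Lemma gval_mul a b : gval R (gmul a b) = gval R a * gval R b.
Proof. by rewrite /gval /gmul /= !intrD !intrM; ring: (phi2 R). Qed.

Lemma gpos_gt0 c : gpos c -> 0 < gval R c.
Proof.
have h1 : 21 / 13 < phi by have := phi_gt R; lra.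
have h2 : phi < 34 / 21 by have := phi_lt R; have := phi2 R; nra.
rewrite /gpos /gval; case: ifP => hb hc.
  have k1 : 0 <= c.2%:~R :> R by rewrite ler0z.
  have k2 : 0 < 13 * c.1%:~R + 21 * c.2%:~R :> R by move: hc; rewrite -(ltr0z R) intrD !intrM.
  nra.
have k1 : c.2%:~R < 0 :> R by rewrite ltrz0 ltNge hb.
have k2 : 0 < 21 * c.1%:~R + 34 * c.2%:~R :> R by move: hc; rewrite -(ltr0z R) intrD !intrM.
nra.
Qed.

Lemma gnneg_ge0 c : gnneg c -> 0 <= gval R c.
Proof.
case/orP => [/eqP ->|/gpos_gt0/ltW//].
by rewrite /gval /= mul0r addr0.
Qed.

Definition slack (h : constr) (x : R * R) : R :=
  if h.1.2 then form h.1.1 x - gval R h.2 else gval R h.2 - form h.1.1 x.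

Lemma slack_gval h z : slack h (gval2 R z) = gval R (slackz h z).
Proof. by rewrite /slack /slackz; case: ifP => _; rewrite form_gval gvalB. Qed.

Lemma slack_negc h x : slack (negc h) x = - slack h x.
Proof. by rewrite /slack /=; case: h.1.2; rewrite /= opprB. Qed.

Definition sat (Q : seq constr) (x : R * R) : bool := all (fun h => 0 < slack h x) Q.

Lemma form_relP d1 d2 d3 k1 k2 k3 x : form_rel d1 d2 d3 = Some (k1, k2, k3) ->
  gval R k1 * form d1 x + gval R k2 * form d2 x + gval R k3 * form d3 x = 0.
Proof.
by case: d1 d2 d3 => [] [] [] //= [<- <- <-]; rewrite /gval /=; ring: (phi2 R).
Qed.

Lemma form_rel_sign d1 d2 d3 k1 k2 k3 : form_rel d1 d2 d3 = Some (k1, k2, k3) ->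
  [/\ d1 != d2, d1 != d3, d2 != d3 & forall k, k \in [:: k1; k2; k3] ->
     if gpos k then 0 < gval R k else gval R k < 0].
Proof.
move=> h; split; try by move: h; case: d1 d2 d3 => [] [] [].
move=> k hk; case: ifP => [/gpos_gt0//|hn].
suff : gpos (- k) by move=> /gpos_gt0; rewrite gvalN oppr_gt0.
by move: h hk hn; case: d1 d2 d3 => [] [] [] //= [<- <- <-];
  rewrite !inE => /or3P[] /eqP ->; vm_compute.
Qed.

Lemma clash2P h1 h2 x : clash2 h1 h2 -> h1 != h2 /\ slack h1 x + slack h2 x <= 0.
Proof.
case/and4P => /eqP hd s1 s2 /gnneg_ge0; rewrite gvalB => hc.
split; first by apply: contraNneq s2 => <-.
by rewrite /slack s1 (negbTE s2) hd; lra.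
Qed.

Lemma clash3P h1 h2 h3 x : clash3 h1 h2 h3 -> [/\ h1 != h2, h1 != h3, h2 != h3 &
  exists k1 k2 k3 : R, [/\ 0 < k1, 0 < k2, 0 < k3 &
    k1 * slack h1 x + k2 * slack h2 x + k3 * slack h3 x <= 0]].
Proof.
rewrite /clash3; case E : form_rel => [[[k1 k2] k3]|] //.
have [n12 n13 n23 hs] := form_rel_sign E; have := form_relP x E.
have := hs k1; rewrite inE eqxx /= => /(_ isT).
have := hs k2; rewrite !inE eqxx orbT /= => /(_ isT).
have := hs k3; rewrite !inE eqxx !orbT /= => /(_ isT).
move=> g3 g2 g1 hr hc; split; try by apply: contraNneq n12 => ->.
- by apply: contraNneq n13 => ->.
- by apply: contraNneq n23 => ->.
exists `|gval R k1|, `|gval R k2|, `|gval R k3|.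
have nz (k : zphi) : (if gpos k then 0 < gval R k else gval R k < 0) -> 0 < `|gval R k|.
  by case: ifP => _ h; rewrite normr_gt0; [rewrite gt_eqF|rewrite lt_eqF].
split; [exact: nz|exact: nz|exact: nz|].
case/orP: hc => /and4P[/eqP s1 /eqP s2 /eqP s3 /gnneg_ge0]; rewrite ?gvalN !gvalD !gval_mul /slack s1 s2 s3;
  move: g1 g2 g3; case: (gpos k1); case: (gpos k2); case: (gpos k3) => /= g1 g2 g3;
  rewrite ?(gtr0_norm g1) ?(gtr0_norm g2) ?(gtr0_norm g3) ?(ltr0_norm g1) ?(ltr0_norm g2) ?(ltr0_norm g3); lra.
Qed.

(** The head constraint need only hold weakly: the constraints in a certificate are distinct, so one
    of them is strict and has a positive weight, and the sum is still positive. *)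
Lemma infeasibleP h0 L x : infeasible (h0 :: L) -> 0 <= slack h0 x -> sat L x -> False.
Proof.
move=> hi hw hs.
have w h : h \in h0 :: L -> 0 <= slack h x.
  by rewrite inE => /orP[/eqP -> //|/(allP hs)/ltW].
have st h : h \in h0 :: L -> h != h0 -> 0 < slack h x.
  by rewrite inE => /orP[/eqP ->|/(allP hs)//]; rewrite eqxx.
case/hasP: hi => h1 m1 /hasP[h2 m2] /orP[/(clash2P x)[n12 hle]|/hasP[h3 m3] /(clash3P x)].
  have [e|n] := eqVneq h1 h0.
    by have := st _ m2; rewrite -e eq_sym => /(_ n12); have := w _ m1; lra.
  by have := st _ m1 n; have := w _ m2; lra.
case=> n12 n13 n23 [k1 [k2 [k3 [p1 p2 p3 hle]]]].
have := w _ m1; have := w _ m2; have := w _ m3 => w3 w2 w1.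
have [e|n] := eqVneq h1 h0.
  have := st _ m2; rewrite -e eq_sym => /(_ n12) q.
  by have := mulr_gt0 p2 q; have := mulr_ge0 (ltW p1) w1; have := mulr_ge0 (ltW p3) w3; lra.
have q := st _ m1 n.
by have := mulr_gt0 p1 q; have := mulr_ge0 (ltW p2) w2; have := mulr_ge0 (ltW p3) w3; lra.
Qed.

Lemma infeasible_sat L x : infeasible L -> ~~ sat L x.
Proof.
case: L => [//|h0 L] hi; apply/negP => /= /andP[h0x hL].
exact: (infeasibleP hi (ltW h0x) hL).
Qed.

Lemma sat_tighten h L x : 0 < slack h x -> sat L x -> sat (tighten h L) x.
Proof.
rewrite /tighten => hh hL; case: ifP => // _; rewrite /sat /= hh /=.
by apply/allP => g; rewrite mem_filter => /andP[_ /(allP hL)].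
Qed.

(** Since x lies on no edge line, it satisfies each constraint or its negation strictly and can be
    followed through the branches. *)
Lemma coversP L Qs x : covers L Qs -> sat L x ->
  (forall Q, Q \in Qs -> forall h, h \in Q -> slack h x != 0) -> has (sat^~ x) Qs.
Proof.
elim: Qs L => [|Q Qs IH] L.
  by rewrite /=; case: ifP => // /infeasible_sat/negbTE ->.
rewrite [covers _ _]/=; case: ifP => [/infeasible_sat/negbTE -> //|_].
have gQs : (forall Q', Q' \in Q :: Qs -> forall h, h \in Q' -> slack h x != 0) ->
    forall Q', Q' \in Qs -> forall h, h \in Q' -> slack h x != 0.
  by move=> hg Q' hQ'; apply: hg; rewrite inE hQ' orbT.
case: ifP => [_ hc hL /gQs hg|_ hb hL hg] /=; apply/orP; first by right; exact: IH hc hL hg.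
have {}gQs := gQs hg.
have gQ h : h \in Q -> slack h x != 0 by apply: hg; rewrite inE eqxx.
suff H T : {subset T <= Q} -> (fix branch (L0 : seq constr) (Q0 : seq constr) {struct Q0} : bool :=
          if Q0 is h :: Q' then covers (tighten (negc h) L0) Qs && branch (tighten h L0) Q' else true) L T ->
    sat T x \/ has (sat^~ x) Qs.
  exact: (H Q (fun _ => id) hb).
move=> {hb}; elim: T L hL => [|h T IHT] L hL hs; first by left.
move=> /andP[c1 c2]; have [hp|hp] := ltP 0 (slack h x).
  have [|hT|] := IHT _ (sat_tighten hp hL) _ c2; last by right.
    by move=> g hg'; apply: hs; rewrite inE hg' orbT.
  by left; rewrite /sat /= hp.
right; apply: (IH _ c1) => //; apply: sat_tighten => //.
by rewrite slack_negc oppr_gt0 lt_neqAle hp andbT gQ// hs// inE eqxx.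
Qed.

End Pieces.

(** * Interiors of polygons as regions cut out by half-planes *)

Section PlaneTopology.
Variable R : realType.
Local Notation phi := (phi R).

Lemma form_continuous d : continuous (form d : R * R -> R).
Proof.
have c1 : continuous (fst : R * R -> R) by move=> x; exact: cvg_fst.
have c2 : continuous (snd : R * R -> R) by move=> x; exact: cvg_snd.
case: d.
- by have -> : form DX = fst :> (R * R -> R) by [].
- by have -> : form DY = snd :> (R * R -> R) by [].
- have -> : form D1 = (fun p => p.2 - phi * p.1) :> (R * R -> R) by [].
  by move=> x; apply: cvgB; [exact: c2 | apply: cvgMr; exact: c1].
- have -> : form D2 = (fun p => p.2 - phi * (phi * p.1)) :> (R * R -> R) by [].
  by move=> x; apply: cvgB; [exact: c2 | apply: cvgMr; apply: cvgMr; exact: c1].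
Qed.

Lemma slack_continuous h : continuous (slack h : R * R -> R).
Proof.
rewrite /slack; case: h.1.2 => x.
  by apply: cvgB; [exact: form_continuous|exact: cvg_cst].
by apply: cvgB; [exact: cvg_cst|exact: form_continuous].
Qed.

Lemma open_slack_gt0 h : open [set x : R * R | 0 < slack h x].
Proof.
apply: (@open_comp _ _ (slack h) [set y | 0 < y]); last exact: open_gt.
by move=> x _; exact: slack_continuous.
Qed.

Lemma closed_slack_ge0 h : closed [set x : R * R | 0 <= slack h x].
Proof.
apply: (@preimage_closed _ _ (slack h) [set y | 0 <= y]); last exact: closed_ge.
by move=> x _; exact: slack_continuous.
Qed.

Lemma open_sat Q : open [set x : R * R | sat Q x].
Proof.
elim: Q => [|h Q IH]; first have -> : [set x : R * R | sat [::] x] = setT by apply/seteqP; split.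
  exact: openT.
rewrite (_ : [set _ | _] = [set x | 0 < slack h x] `&` [set x | sat Q x]).
  by apply: openI => //; exact: open_slack_gt0.
by apply/seteqP; split=> x /=; [move=> /andP[]|move=> [-> ?]].
Qed.

Definition wsat Q (x : R * R) : bool := all (fun h => 0 <= slack h x) Q.

Lemma closed_wsat Q : closed [set x : R * R | wsat Q x].
Proof.
elim: Q => [|h Q IH]; first have -> : [set x : R * R | wsat [::] x] = setT by apply/seteqP; split.
  exact: closedT.
rewrite (_ : [set _ | _] = [set x | 0 <= slack h x] `&` [set x | wsat Q x]).
  by apply: closedI => //; exact: closed_slack_ge0.
by apply/seteqP; split=> x /=; [move=> /andP[]|move=> [-> ?]].
Qed.

(** Off the boundary, U and K coincide, so U is open and closed in the complement and contains the
    component of each of its points, which is thus bounded. A point outside K and off the boundary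
    has a whole ray in its component, which is thus unbounded. *)
Lemma polygon_interior_eq (V : seq (R * R)) (U K : set (R * R)) :
  open U -> closed K -> U `<=` K -> K `<=` U `|` polygon_boundary V ->
  polygon_boundary V `&` U = set0 -> bounded_set U ->
  (forall x, ~ K x -> ~ polygon_boundary V x -> exists2 r : R * R, r != 0 &
     forall k, 0 <= k -> ~ polygon_boundary V (x.1 + k * r.1, x.2 + k * r.2)) ->
  polygon_interior V = U.
Proof.
move=> oU cK UK KU bU bdU ray; apply/seteqP; split=> x.
- move=> [nb bd]; apply: contrapT => nU.
  have nK : ~ K x by move=> /KU[].
  have [r r0 hr] := ray x nK nb.
  pose g (k : R) : R * R := (x.1 + k * r.1, x.2 + k * r.2).
  have sub : g @` [set` `[0, +oo[] `<=` connected_component (~` polygon_boundary V) x.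
    apply: connected_component_max.
    - exists 0 => /=; first by rewrite in_itv /= lexx.
      by rewrite /g !mul0r !addr0; case: (x).
    - by move=> _ [k /=] + <-; rewrite in_itv /= andbT => /hr.
    - apply: connected_continuous_connected.
        by apply/connected_intervalP; exact: interval_is_interval.
      apply: continuous_subspaceT => k; apply: (@cvg_pair _ _ _ _ (nbhs _) (nbhs _)) => /=.
        by apply: cvgD; [exact: cvg_cst|apply: cvgMl; exact: cvg_id].
      by apply: cvgD; [exact: cvg_cst|apply: cvgMl; exact: cvg_id].
  have [M0 [_ /(_ (M0 + 1) ltac:(lra)) hM]] := bd; set M := M0 + 1 in hM.
  have hk k : 0 <= k -> `|x.1 + k * r.1| <= M /\ `|x.2 + k * r.2| <= M.
    move=> k0; have : `|g k| <= M by apply/hM/sub; exists k => //=; rewrite in_itv /= k0.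
    by rewrite prod_normE ge_max /= => /andP[].
  have [m1 m2] := hk 0 (lexx 0); rewrite !mul0r !addr0 in m1 m2.
  have Mge0 : 0 <= M by apply: le_trans m1.
  have bnd (a b : R) : `|a| <= M -> (forall k, 0 <= k -> `|a + k * b| <= M) -> b = 0.
    move=> ha hb; apply/eqP; rewrite -normr_le0 leNgt; apply/negP => b0.
    have := hb ((2 * M + 1) / `|b|) (divr_ge0 _ (ltW b0)).
    move=> /(_ ltac:(lra)) h1.
    have : `|(2 * M + 1) / `|b| * b| <= 2 * M.
      have -> : (2 * M + 1) / `|b| * b = (a + (2 * M + 1) / `|b| * b) - a by ring.
      by apply: le_trans (ler_normB _ _) _; lra.
    rewrite normrM normf_div normr_id divfK ?gt_eqF// ger0_norm; lra.
  have e1 : r.1 = 0 by apply: (bnd x.1) => // k /hk[].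
  have e2 : r.2 = 0 by apply: (bnd x.2) => // k /hk[].
  by move/eqP: r0; apply; rewrite [r]surjective_pairing e1 e2.
- move=> Ux; have nb : ~ polygon_boundary V x.
    by move=> bx; have : (polygon_boundary V `&` U) x by []; rewrite bU.
  split=> //; set C := connected_component _ x.
  have CU : C `&` U = C.
    apply: (component_connected (A := ~` polygon_boundary V) (x := x)).
    - by exists x; split=> //; exact: connected_component_refl.
    - by exists U.
    - exists K => //; apply/seteqP; split=> y [Cy]; first by move=> /UK.
      move=> /KU[//|by_]; have := connected_component_sub Cy; by [].
  case: bdU => M [Mr hM]; exists M; split=> // N MN y Cy.
  by apply: (hM N MN); move: Cy; rewrite -CU => -[].
Qed.

Lemma edge_slack (p q : R * R) h t :
  slack h ((1 - t) * p.1 + t * q.1, (1 - t) * p.2 + t * q.2) =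
  (1 - t) * slack h p + t * slack h q.
Proof. by rewrite /slack; case: ifP => _; case: (h.1.1) => /=; ring. Qed.

End PlaneTopology.

Section Polygons.
Variable R : realType.
Local Notation phi := (phi R).
Local Notation zpts := (seq (zphi * zphi)).

Lemma form_inj d e (x y : R * R) : d != e -> form d x = form d y -> form e x = form e y -> x = y.
Proof.
have h1 := phi_gt R; have h2 := phi2 R; have hp : phi != 0 by rewrite gt_eqF//; lra.
case: x y => [x1 x2] [y1 y2]; wlog hlt : d e / (dir_nat d < dir_nat e)%N.
  move=> h de; have [hlt|hlt|/(can_inj dir_natK) /eqP] := ltngtP (dir_nat d) (dir_nat e).
  - exact: h.
  - by move=> a b; apply: (h _ _ hlt) => //; rewrite eq_sym.
  - by rewrite (negbTE de).
case: d e hlt => [] [] //= _ _ a b; first by rewrite a b.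
- by congr pair => //; rewrite a in b; lra.
- by congr pair => //; rewrite a in b; lra.
- by congr pair => //; apply: (mulfI hp); lra.
- by congr pair => //; apply: (mulfI hp); apply: (mulfI hp); lra.
- have e z : phi * (phi * z) = phi * z + z by rewrite mulrA h2; ring.
  have e1 : x1 = y1 by rewrite !e in b; lra.
  by rewrite e1 in a *; congr pair; lra.
Qed.

Lemma line_param d e (p q x : R * R) : d != e -> form d p = form d q -> form d p = form d x ->
  form e p != form e q -> exists k, x = ((1 - k) * p.1 + k * q.1, (1 - k) * p.2 + k * q.2).
Proof.
move=> de h1 h2 h3; set k := (form e x - form e p) / (form e q - form e p).
have hk : k * (form e q - form e p) = form e x - form e p by rewrite divfK// subr_eq0 eq_sym.
exists k; have hl g : form g ((1 - k) * p.1 + k * q.1, (1 - k) * p.2 + k * q.2) = form g p + k * (form g q - form g p).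
  by case: g => /=; ring.
apply: (form_inj de); rewrite hl; first by rewrite -h1 -h2 subrr mulr0 addr0.
by rewrite hk; ring.
Qed.

Lemma polygon_boundaryP (V : zpts) (x : R * R) : polygon_boundary (map (gval2 R) V) x <->
  exists2 e, e \in zip V (rot 1 V) & polygon_edge (gval2 R e.1) (gval2 R e.2) x.
Proof.
rewrite /polygon_boundary -map_rot /=.
have -> : zip (map (gval2 R) V) (map (gval2 R) (rot 1 V)) =
    map (fun e => (gval2 R e.1, gval2 R e.2)) (zip V (rot 1 V)).
  by elim: V (rot 1 V) => [|a V IH] [|b W] //=; rewrite IH.
split=> [[e /mapP[e' he' ->] hx]|[e he hx]]; first by exists e'.
by exists (gval2 R e.1, gval2 R e.2) => //; apply/mapP; exists e.
Qed.

Lemma avoidsP (V : zpts) W (x : R * R) : avoids V W ->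
  polygon_boundary (map (gval2 R) V) x -> ~~ sat W x.
Proof.
move=> /allP hV /polygon_boundaryP[e he [k hk ->]]; apply/negP => /allP hs.
have /hasP[h hW /andP[/(gnneg_ge0 R) h1 /(gnneg_ge0 R) h2]] := hV e he.
have := hs h hW; rewrite edge_slack !slack_gval.
rewrite !gvalN in h1 h2; nra.
Qed.

Definition line_dir d : R * R :=
  match d with DX => (0, 1) | DY => (1, 0) | D1 => (1, phi) | D2 => (1, phi * phi) end.

Lemma line_dir_neq0 d : line_dir d != 0.
Proof. by apply/negP => /eqP; case: d => [] [] /eqP; rewrite ?oner_eq0 //= => _ /eqP; rewrite oner_eq0. Qed.

Lemma slack_line h (x : R * R) k :
  slack h (x.1 + k * (line_dir h.1.1).1, x.2 + k * (line_dir h.1.1).2) = slack h x.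
Proof. by rewrite /slack; case: ifP => _; case: (h.1.1) => /=; ring. Qed.

Lemma in_box_bounded (U : set (R * R)) :
  (forall x, U x -> 0 <= x.1 <= phi /\ 0 <= x.2 <= phi + 3) -> bounded_set U.
Proof.
move=> hU; exists 5; split=> // M hM x /hU[h1 h2]; rewrite /= prod_normE ge_max /=.
by have := phi_lt R; rewrite !ler_norml => h3; apply/andP; split; lra.
Qed.

(** A point with all slacks nonnegative and one zero lies on that edge line, and the two
    neighbouring edges confine its parameter to [0, 1]. A point violating one constraint escapes
    along a ray parallel to that edge, inside a half-plane missing the boundary. *)
Lemma convex_interior V : convex_check V ->
  (forall x : R * R, sat (edge_constrs V) x -> 0 <= x.1 <= phi /\ 0 <= x.2 <= phi + 3) ->
  polygon_interior (map (gval2 R) V) = [set x | sat (edge_constrs V) x].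
Proof.
case/and3P => a1 /allP a2 /allP a3 hbox.
apply: (@polygon_interior_eq _ _ _ [set x | wsat (edge_constrs V) x]).
- exact: open_sat.
- exact: closed_wsat.
- by move=> x /=; apply: sub_all => h /ltW.
- move=> x /= /allP hw; have [|/allPn[h hQ]] := boolP (sat (edge_constrs V) x); first by left.
  rewrite -leNgt => h0; right; apply/polygon_boundaryP.
  have {h0} h0 : slack h x = 0 by apply/eqP; rewrite eq_le h0 hw.
  case/mapP: (hQ) => e he hE; exists e => //.
  have /and4P[/eqP e1 /eqP e2 /hasP[g gQ /andP[/eqP g1 /(gpos_gt0 R) g2]]
    /hasP[g' gQ' /andP[/eqP g1' /(gpos_gt0 R) g2']]] := a3 e he.
  have gv0 : gval R 0 = 0 by rewrite /gval /= mul0r addr0.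
  rewrite -hE in e1 e2.
  have s1 : slack h (gval2 R e.1) = 0 by rewrite slack_gval e1.
  have s2 : slack h (gval2 R e.2) = 0 by rewrite slack_gval e2.
  have t1 : slack g (gval2 R e.1) = 0 by rewrite slack_gval g1.
  have t2 : 0 < slack g (gval2 R e.2) by rewrite slack_gval; exact: g2.
  have t1' : slack g' (gval2 R e.2) = 0 by rewrite slack_gval g1'.
  have t2' : 0 < slack g' (gval2 R e.1) by rewrite slack_gval; exact: g2'.
  have slackE f y z : slack f y = slack f z <-> form f.1.1 y = form f.1.1 z.
    by rewrite /slack; case: ifP => _; split; lra.
  have l1 : form h.1.1 (gval2 R e.1) = form h.1.1 (gval2 R e.2) by apply/slackE; rewrite s1 s2.
  have l2 : form h.1.1 (gval2 R e.1) = form h.1.1 x by apply/slackE; rewrite s1 h0.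
  have l3 : form g.1.1 (gval2 R e.1) != form g.1.1 (gval2 R e.2).
    by apply/eqP => /slackE; rewrite t1 => tt; move: t2; rewrite -tt ltxx.
  have dn : h.1.1 != g.1.1 by apply: contraNneq l3 => <-; rewrite l1.
  have [k hk] := line_param dn l1 l2 l3; exists k => //.
  have := hw _ gQ; have := hw _ gQ'; rewrite hk !edge_slack t1 t1'; nra.
- by apply/seteqP; split=> // x [] /(avoidsP a1)/negP.
- by apply: in_box_bounded => x /hbox.
- move=> x /negP; rewrite -has_predC => /hasP[h hQ]; rewrite /= -ltNge => h0 _.
  exists (line_dir h.1.1); first exact: line_dir_neq0.
  move=> k _ /(avoidsP (a2 h hQ)); rewrite /sat /= slack_negc slack_line andbT oppr_gt0.
  by rewrite h0.
Qed.

(** The argument of [convex_interior] for a union of two convex regions. The edges AB, ..., FA are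
    named after the vertices in the order of V. *)
Lemma hexagon_interior (V := [:: ((0, 0), (1, 1)); ((-1, 1), (2, 1)); ((1, 0), (3, 1));
    ((2, -1), (2, 1)); ((2, -1), (3, 1)); ((0, 0), (2, 1))] : zpts) :
  (forall Q (x : R * R), Q \in hexagon_regions -> sat Q x -> 0 <= x.1 <= phi /\ 0 <= x.2 <= phi + 3) ->
  polygon_interior (map (gval2 R) V) = [set x : R * R | has (fun Q => sat Q x) hexagon_regions].
Proof.
have p1 := phi_gt R; have p2 := phi_lt R; have pp := phi2 R.
move=> hbox; pose Q1 := nth [::] hexagon_regions 0; pose Q2 := nth [::] hexagon_regions 1.
have ray d W : avoids V W -> forall x : R * R, sat W x ->
    (forall k, 0 <= k -> sat W (x.1 + k * (line_dir d).1, x.2 + k * (line_dir d).2)) ->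
    exists2 r : R * R, r != 0 & forall k, 0 <= k ->
      ~ polygon_boundary (map (gval2 R) V) (x.1 + k * r.1, x.2 + k * r.2).
  move=> hW x hx hk; exists (line_dir d); first exact: line_dir_neq0.
  by move=> k k0 /(avoidsP hW); rewrite hk.
have ray1 h : avoids V [:: h] -> forall x : R * R, 0 < slack h x -> exists2 r : R * R, r != 0 &
    forall k, 0 <= k -> ~ polygon_boundary (map (gval2 R) V) (x.1 + k * r.1, x.2 + k * r.2).
  move=> hW x hx; apply: (ray h.1.1 _ hW) => [|k k0]; by rewrite /sat /= ?slack_line hx.
have onedge i d e : (i < 6)%N -> d != e -> forall x : R * R,
    let p := nth ((0, 0), (0, 0)) V i in let q := nth ((0, 0), (0, 0)) V (i.+1 %% 6) in
    form d (gval2 R p) = form d (gval2 R q) -> form d (gval2 R p) = form d x ->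
    form e (gval2 R p) <= form e x <= form e (gval2 R q) \/ form e (gval2 R q) <= form e x <= form e (gval2 R p) ->
    form e (gval2 R p) != form e (gval2 R q) -> polygon_boundary (map (gval2 R) V) x.
  move=> hi de x p q l1 l2 l4 l3; apply/polygon_boundaryP; exists (p, q).
    by rewrite /p /q; case: i hi {p q l1 l2 l3 l4} => [|[|[|[|[|[|]]]]]] // _; rewrite !inE eqxx ?orbT.
  have [k hk] := line_param de l1 l2 l3; exists k => //=.
  have hl : form e x = (1 - k) * form e (gval2 R p) + k * form e (gval2 R q).
    by rewrite hk; case: (e) => /=; ring.
  have /eqP l5 : form e (gval2 R q) - form e (gval2 R p) != 0 by rewrite subr_eq0 eq_sym.
  move: l4; rewrite hl; set a := form e _; set b := form e _; rewrite -/a -/b in l5 => l4.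
  have [lt|gt|//] := ltgtP a b; last by move=> ab; exfalso; apply: l5; rewrite ab subrr.
    by case: l4 => l4; nra.
  by case: l4 => l4; nra.
have gE (a b : int) : gval R (a, b) = a%:~R + b%:~R * phi by [].
have F2E (a b : R) : b - phi * (phi * a) = b - phi * a - a by rewrite mulrA pp; ring.
have satE (x : R * R) : has (fun Q => sat Q x) hexagon_regions =
    [&& 0 < x.1, x.1 < 2 - phi, 1 + phi < x.2 - phi * x.1 & x.2 - phi * x.1 - x.1 < 2 + phi] ||
    [&& 0 < x.1, 1 + phi < x.2 - phi * x.1, 2 < x.2 - phi * x.1 - x.1 & x.2 - phi * x.1 < 3].
  rewrite /sat /hexagon_regions /= /slack /= !gE !F2E !subr_gt0 !(mul0r, mul1r, mulN1r, addr0, orbF, andbT).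
  by [].
have wsatE (x : R * R) : has (fun Q => wsat Q x) hexagon_regions =
    [&& 0 <= x.1, x.1 <= 2 - phi, 1 + phi <= x.2 - phi * x.1 & x.2 - phi * x.1 - x.1 <= 2 + phi] ||
    [&& 0 <= x.1, 1 + phi <= x.2 - phi * x.1, 2 <= x.2 - phi * x.1 - x.1 & x.2 - phi * x.1 <= 3].
  rewrite /wsat /hexagon_regions /= /slack /= !gE !F2E !subr_ge0 !(mul0r, mul1r, mulN1r, addr0, orbF, andbT).
  by [].
have AB a b : b - phi * a = 1 + phi -> 0 <= a <= phi - 1 -> polygon_boundary (map (gval2 R) V) (a, b).
  by move=> h1 h2; apply: (@onedge 0 D1 DX) => //=; rewrite !gE; [ring: pp|lra|left; lra|apply/eqP; lra].
have BC a b : b - phi * a - a = 2 -> phi - 1 <= a <= 1 -> polygon_boundary (map (gval2 R) V) (a, b).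
  by move=> h1 h2; apply: (@onedge 1 D2 DX) => //=; rewrite ?F2E !gE; [ring: pp|nra|left; lra|apply/eqP; lra].
have CD a b : b - phi * a = 3 -> 2 - phi <= a <= 1 -> polygon_boundary (map (gval2 R) V) (a, b).
  by move=> h1 h2; apply: (@onedge 2 D1 DX) => //=; rewrite !gE; [ring: pp|lra|right; lra|apply/eqP; lra].
have DE a b : a = 2 - phi -> 2 + phi <= b <= 3 + phi -> polygon_boundary (map (gval2 R) V) (a, b).
  by move=> h1 h2; apply: (@onedge 3 DX DY) => //=; rewrite !gE; [lra|left; lra|apply/eqP; lra].
have EF a b : b - phi * a - a = 2 + phi -> 0 <= a <= 2 - phi -> polygon_boundary (map (gval2 R) V) (a, b).
  by move=> h1 h2; apply: (@onedge 4 D2 DX) => //=; rewrite ?F2E !gE; [ring: pp|nra|right; lra|apply/eqP; lra].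
have FA a b : a = 0 -> 1 + phi <= b <= 2 + phi -> polygon_boundary (map (gval2 R) V) (a, b).
  by move=> h1 h2; apply: (@onedge 5 DX DY) => //=; rewrite !gE; [lra|right; lra|apply/eqP; lra].
apply: (@polygon_interior_eq _ _ _ [set x : R * R | has (fun Q => wsat Q x) hexagon_regions]).
- rewrite (_ : [set _ | _] = [set x : R * R | sat Q1 x] `|` [set x | sat Q2 x]).
    by apply: openU; exact: open_sat.
  by apply/seteqP; split=> x /=; rewrite orbF => /orP.
- rewrite (_ : [set _ | _] = [set x : R * R | wsat Q1 x] `|` [set x | wsat Q2 x]).
    by apply: closedU; exact: closed_wsat.
  by apply/seteqP; split=> x /=; rewrite orbF => /orP.
- by move=> x; apply: sub_has => Q; apply: sub_all => h /ltW.
- move=> x; rewrite [X in X -> _]/mkset => hw.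
  have [hs|ns] := boolP (has (fun Q => sat Q x) hexagon_regions); first by left.
  right; move: hw ns; rewrite wsatE satE; case: x => a b /= hw /norP[n1 n2].
  have neq (y z : R) : y <= z -> y != z -> y < z by move=> h1 h2; rewrite lt_neqAle h2.
  have [a0|a0] := eqVneq a 0.
    by apply: FA => //; move: hw; rewrite a0 mulr0 => /orP[] /and4P[]; lra.
  have [f1|f1] := eqVneq (b - phi * a) (1 + phi).
    by apply: AB => //; move: hw => /orP[] /and4P[]; lra.
  have a0' : 0 <= a by case/orP: hw => /and4P[].
  have f1' : 1 + phi <= b - phi * a by case/orP: hw => /and4P[].
  have {a0 a0'} a0 : 0 < a by apply: neq; rewrite // eq_sym.
  have {f1 f1'} f1 : 1 + phi < b - phi * a by apply: neq; rewrite // eq_sym.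
  case/orP: hw => /and4P[_ h2 h3 h4].
  + have [f2|f2] := eqVneq (b - phi * a - a) (2 + phi); first by apply: EF => //; lra.
    have [at_|at_] := eqVneq a (2 - phi); last first.
      by exfalso; apply: (negP n1); rewrite a0 f1 !neq.
    have ca : phi * a = phi - 1 by rewrite at_; ring: pp.
    have [hb|hb] := leP (2 + phi) b; first by apply: DE => //; lra.
    by exfalso; apply: (negP n2); rewrite a0 f1 /=; apply/andP; split; lra.
  + have [f2|f2] := eqVneq (b - phi * a - a) 2; first by apply: BC => //; lra.
    have [f3|f3] := eqVneq (b - phi * a) 3; last first.
      by exfalso; apply: (negP n2); rewrite a0 f1 !neq// eq_sym.
    have [ha|ha] := leP (2 - phi) a; first by apply: CD => //; lra.
    by exfalso; apply: (negP n1); rewrite a0 f1 ha /=; lra.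
- have av : all (avoids V) hexagon_regions by vm_compute.
  apply/seteqP; split=> // x [bd /hasP[Q hQ hs]].
  by move: (avoidsP (allP av _ hQ) bd); rewrite hs.
- by apply: in_box_bounded => x /hasP[Q /hbox]; apply.
- move=> x /negP; rewrite wsatE negb_or => /andP[k1 k2] _.
  have [x0|x0] := ltP x.1 0.
    by apply: (ray1 (DX, false, (0, 0))); rewrite // /slack /= gE; lra.
  have [f1|f1] := ltP (x.2 - phi * x.1) (1 + phi).
    by apply: (ray1 (D1, false, (1, 1))); rewrite // /slack /= gE; lra.
  have [f2|f2] := ltP (2 + phi) (x.2 - phi * x.1 - x.1).
    by apply: (ray1 (D2, true, (2, 1))); rewrite // /slack /= gE F2E; lra.
  have [f3|f3] := ltP (x.2 - phi * x.1 - x.1) 2.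
    by apply: (ray1 (D2, false, (2, 0))); rewrite // /slack /= gE F2E; lra.
  rewrite x0 f1 f2 f3 /= in k1 k2; rewrite andbT -ltNge in k1; rewrite -ltNge in k2.
  (* What remains is the notch between the edges CD and DE at the reflex vertex (phi^-2, phi + 2);
     it is left by going vertically upwards. *)
  apply: (ray DX [:: (DX, true, (2, -1)); (D1, true, (3, 0))]) => // [|k k0];
    rewrite /sat /= /slack /= !gE andbT; apply/andP; split; lra.
Qed.
End Polygons.

(** * The atoms on the torus *)

Lemma hexagon_unique : all (fun a => all (fun V => (size V == 6) ==> (V ==
    [:: ((0, 0), (1, 1)); ((-1, 1), (2, 1)); ((1, 0), (3, 1));
        ((2, -1), (2, 1)); ((2, -1), (3, 1)); ((0, 0), (2, 1))])) (polygon_data a)) (iota 0 11).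
Proof. by vm_compute. Qed.

Section Atoms.
Variable R : realType.
Local Notation phi := (phi R).

Definition in_atom a (x : R * R) : bool := has (fun Q => sat Q x) (pieces a).

Lemma P0_polygonsE (a : 'I_11) : P0_polygons R a = map (map (gval2 R)) (polygon_data a).
Proof.
have pp := phi2 R; have p0 : phi != 0 by rewrite gt_eqF//; have := phi_gt R; lra.
have s1 : phi^-1 = phi - 1 by apply: (mulfI p0); rewrite mulfV//; ring: pp.
have s2 : phi ^- 2 = 2 - phi.
  by rewrite expr2 invfM s1; ring: pp.
rewrite /P0_polygons s1 s2; case: a => a ha.
do 11 (case: a ha => [|a] ha; first by
  rewrite /= /gval2 /gval /=; repeat (congr (_ :: _) => //); congr pair; ring).
by [].
Qed.

Lemma all_below (P : nat -> bool) a : all P (iota 0 11) -> (a < 11)%N -> P a.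
Proof. by move=> /allP h ha; apply: h; rewrite mem_iota. Qed.

Lemma polygon_index a V : V \in polygon_data a -> (a < 11)%N.
Proof. by rewrite /polygon_data; do 11 (case: a => [|a] //); rewrite /= nth_nil. Qed.

Lemma piece_index a Q : Q \in pieces a -> (a < 11)%N.
Proof. by move=> /flatten_mapP[V /polygon_index]. Qed.

Lemma piece_box a Q (x : R * R) : Q \in pieces a -> sat Q x ->
  (0 < x.1 < phi) /\ (0 < x.2 < phi + 3).
Proof.
move=> hQ hs; have ha := piece_index hQ.
have hQ' : Q \in all_pieces.
  by apply/flatten_mapP; exists a => //; rewrite mem_iota.
have hb h : h \in box_constrs -> 0 < slack h x.
  move=> hh; rewrite ltNge; apply/negP => hn.
  have := allP (allP pieces_in_box Q hQ') h hh.
  by move/(infeasibleP (R := R) (x := x)); apply => //; rewrite slack_negc oppr_ge0.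
have := hb (DX, true, (0, 0)); have := hb (DX, false, (0, 1)).
have := hb (DY, true, (0, 0)); have := hb (DY, false, (3, 1)).
rewrite !inE !eqxx ?orbT /slack /gval /= => /(_ isT) h1 /(_ isT) h2 /(_ isT) h3 /(_ isT) h4.
split; lra.
Qed.

Lemma atom_box a (x : R * R) : in_atom a x -> (0 < x.1 < phi) /\ (0 < x.2 < phi + 3).
Proof. by move=> /hasP[Q hQ]; exact: piece_box hQ. Qed.

Lemma atom_index a (x : R * R) : in_atom a x -> (a < 11)%N.
Proof. by move=> /hasP[Q /piece_index]. Qed.

Lemma atom_disjoint a b (x : R * R) : in_atom a x -> in_atom b x -> a = b.
Proof.
move=> ha hb; apply/eqP; case: eqP => // /eqP /negbTE nab.
have := all_below (all_below pieces_disjoint (atom_index ha)) (atom_index hb).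
rewrite /= nab /=; case/hasP: ha hb => Q hQ hx /hasP[Q' hQ' hx'].
move=> /allP/(_ Q hQ)/allP/(_ Q' hQ')/(infeasible_sat (R := R) x).
by rewrite /sat all_cat -!/(sat _ _) hx hx'.
Qed.

Lemma regions_interior a V : V \in polygon_data a ->
  polygon_interior (map (gval2 R) V) = [set x | has (fun Q => sat Q x) (regions V)].
Proof.
move=> hV; have ha := polygon_index hV.
have box Q (x : R * R) : Q \in regions V -> sat Q x -> 0 <= x.1 <= phi /\ 0 <= x.2 <= phi + 3.
  move=> hQ /(@piece_box a Q x)[|h1 h2]; first by apply/flatten_mapP; exists V.
  by split; lra.
have [h6|n6] := boolP (size V == 6); last first.
  have := allP (all_below polygons_convex ha) V hV; rewrite (negbTE n6) /= => hc.
  rewrite /regions (negbTE n6) convex_interior//.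
    by apply/seteqP; split=> x /=; rewrite orbF.
  by move=> x; apply: box; rewrite /regions (negbTE n6) inE.
have := allP (all_below hexagon_unique ha) V hV; rewrite /= h6 => /eqP ->.
rewrite hexagon_interior//.
by move=> Q x hQ; apply: box; rewrite /regions h6.
Qed.

Lemma P0_regionE (a : 'I_11) :
  \bigcup_(V in [set` P0_polygons R a]) polygon_interior V = [set x | in_atom a x].
Proof.
rewrite P0_polygonsE; apply/seteqP; split=> x.
  move=> [_ /mapP[V hV ->]]; rewrite (regions_interior hV) => /hasP[Q hQ hs].
  by apply/hasP; exists Q => //; apply/flatten_mapP; exists V.
move=> /hasP[Q /flatten_mapP[V hV hQ] hs].
exists (map (gval2 R) V); first by apply/mapP; exists V.
by rewrite (regions_interior hV); apply/hasP; exists Q.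
Qed.

Definition latticez (k : Z2) : zphi * zphi := ((k.2, k.1), (k.2 *+ 3, k.2)).
Definition lattice (k : Z2) : R * R := gval2 R (latticez k).

Lemma latticeE k : lattice k = (k.1%:~R * phi + k.2%:~R, k.2%:~R * (phi + 3)).
Proof. by rewrite /lattice /gval2 /gval /= mulrSr mulr2n !intrD; congr pair; ring. Qed.

Lemma latticezB k l : latticez (k - l) = latticez k - latticez l.
Proof. by rewrite /latticez /= mulrnBl. Qed.
Lemma gval2B z w : gval2 R (z - w) = gval2 R z - gval2 R w.
Proof. by rewrite /gval2 !gvalB. Qed.
Lemma latticeB k l : lattice (k - l) = lattice k - lattice l.
Proof. by rewrite /lattice latticezB gval2B. Qed.
Lemma lattice0 : lattice 0 = 0.
Proof. by rewrite -(subrr 0) latticeB subrr. Qed.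
Lemma latticeN k : lattice (- k) = - lattice k.
Proof. by rewrite -sub0r latticeB lattice0 sub0r. Qed.
Lemma latticeD k l : lattice (k + l) = lattice k + lattice l.
Proof. by rewrite -{1}[l]opprK latticeB latticeN opprK. Qed.

Lemma lattice_small k : `|(lattice k).1| < phi -> `|(lattice k).2| < phi + 3 -> k = 0.
Proof.
have p0 := phi_gt R; rewrite latticeE /= => h1 h2.
have e2 : k.2 = 0.
  have : `|k.2%:~R| < 1 :> R by move: h2; rewrite normrM (ger0_norm (_ : 0 <= phi + 3)); [nra|lra].
  by rewrite -intr_norm -[1]/(1%:~R) ltr_int; lia.
have e1 : k.1 = 0.
  have : `|k.1%:~R| < 1 :> R by move: h1; rewrite e2 addr0 normrM (ger0_norm (_ : 0 <= phi)); [nra|lra].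
  by rewrite -intr_norm -[1]/(1%:~R) ltr_int; lia.
by case: k e1 e2 {h1 h2} => ? ? /= -> ->.
Qed.

Local Notation T0 := (torus (phi, 0) (1, phi + 3)).
Local Open Scope quotient_scope.

Lemma zspan_lattice k : (phi, 0) *~ k.1 + (1, phi + 3) *~ k.2 = lattice k :> R * R.
Proof.
rewrite latticeE; case: k => a b /=; rewrite [LHS]surjective_pairing; congr pair.
  by rewrite raddfD /= !raddfMz /= -mulrzl.
by rewrite raddfD /= !raddfMz /= mul0rz add0r -mulrzl.
Qed.

Lemma pi_eq (x y : R * R) : \pi_T0 x = \pi_T0 y <-> exists k, x = y + lattice k.
Proof.
have E : (\pi_T0 x = \pi_T0 y) = (x = y %[mod Quotient.quot (zspan (phi, 0) (1, phi + 3))]) by [].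
rewrite E; split=> [/eqP|[k ->]].
  rewrite -Quotient.idealrBE => /asboolP[m [n h]]; exists (m, n).
  by rewrite -zspan_lattice /= -h addrC subrK.
apply/eqP; rewrite -Quotient.idealrBE; apply/asboolP; exists k.1, k.2.
by rewrite zspan_lattice addrAC subrr add0r.
Qed.

Lemma R0_pi n (x : R * R) : R0 n (\pi_T0 x) = \pi_T0 (x + (n.1%:~R, n.2%:~R)).
Proof.
have E : (1, 0) *~ n.1 + (0, 1) *~ n.2 = (n.1%:~R, n.2%:~R) :> R * R.
  rewrite [LHS]surjective_pairing; congr pair; rewrite raddfD /= !raddfMz /=;
  by rewrite mul0rz ?addr0 ?add0r.
rewrite /R0 /rotation E; apply/esym.
exact: (raddfD (\pi_(Quotient.quot (zspan (phi, 0) (1, phi + 3))))).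
Qed.

Lemma P0_pi (a : 'I_11) (x : R * R) : P0 a (\pi_T0 x) <-> exists k, in_atom a (x - lattice k).
Proof.
rewrite /P0 P0_regionE; split.
  move=> [y hy /esym/pi_eq[k ->]]; exists k; by rewrite addrK.
move=> [k hk]; exists (x - lattice k) => //.
by apply/esym/pi_eq; exists k; rewrite subrK.
Qed.

Lemma pi_surj (p : T0) : exists x, p = \pi_T0 x.
Proof. by exists (repr p); rewrite reprK. Qed.

End Atoms.

(** * Locally allowed configurations are allowed *)

Lemma int_potential (h : int -> int) : exists g : int -> int,
  g 0 = 0 /\ forall i, g (i + 1) = g i + h i.
Proof.
exists (fun i => match i with
  | Posz n => \sum_(k < n) h k%:Z
  (* [Negz n] is -(n + 1), so the sum runs over the arguments -1, ..., -(n + 1). *)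
  | Negz n => - \sum_(k < n.+1) h (Negz k) end).
split=> [|[n|n]]; first exact: big_ord0.
  by rewrite -PoszD addn1 big_ord_recr.
case: n => [|n]; first by rewrite /= big_ord_recr !big_ord0 /= add0r addNr.
have -> : Negz n.+1 + 1 = Negz n by lia.
by rewrite [in RHS]big_ord_recr /= opprD subrK.
Qed.

(** A discrete Poincare lemma: integrate along the axis j = 0, then along each column; closedness on
    unit squares carries the horizontal equation from row 0 to all rows. *)
Lemma plane_potential (h1 h2 : int -> int -> int) :
  (forall i j, h1 i j + h2 (i + 1) j = h2 i j + h1 i (j + 1)) ->
  exists g : int -> int -> int, forall i j,
    g (i + 1) j = g i j + h1 i j /\ g i (j + 1) = g i j + h2 i j.
Proof.
move=> h; have [a [a0 ha]] := int_potential (h1^~ 0).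
have /choice[b hb] : forall i, exists b : int -> int, b 0 = 0 /\ forall j, b (j + 1) = b j + h2 i j.
  by move=> i; exact: int_potential.
exists (fun i j => a i + b i j) => i j; split; last by rewrite (hb i).2 addrA.
suff H k : a (i + 1) + b (i + 1) k - (a i + b i k) - h1 i k = 0.
  by have := H j; clear; lia.
have step l : a (i + 1) + b (i + 1) (l + 1) - (a i + b i (l + 1)) - h1 i (l + 1) =
    a (i + 1) + b (i + 1) l - (a i + b i l) - h1 i l.
  have e : h2 (i + 1) l = h2 i l + h1 i (l + 1) - h1 i l by rewrite -h addrAC subrr add0r.
  by rewrite !(hb _).2 e; ring.
elim/int_rect: k => [|k IH|k IH].
- by rewrite !(hb _).1 ha; clear; lia.
- by rewrite -addn1 PoszD step.
- rewrite -step; have -> : - (k.+1)%:Z + 1 = - k%:Z by lia.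
  exact: IH.
Qed.

Section Shadowing.
Variable R : realType.
Local Notation phi := (phi R).

Definition intvec (n : Z2) : R * R := (n.1%:~R, n.2%:~R).
Definition sup_close (e : R) (x y : R * R) : Prop := `|x.1 - y.1| < e /\ `|x.2 - y.2| < e.
Definition lift_atom (a : nat) (x : R * R) : Prop := exists k, in_atom a (x - lattice R k).
Lemma in_atom_lift a (x : R * R) : in_atom a x -> lift_atom a x.
Proof. by move=> h; exists 0; rewrite lattice0 subr0. Qed.

Definition lattice_index (z : zphi * zphi) : Z2 := (z.1.2, z.2.2).

Lemma gval2_split z : gval2 R z = intvec (nproj z) + lattice R (lattice_index z).
Proof.
rewrite latticeE /gval2 /gval /intvec /nproj /=; case: z => [[a b] [c e]] /=.
by rewrite mulrSr mulr2n !intrB !intrD; congr pair => /=; ring.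
Qed.

Lemma lift_atom_lattice a x k : lift_atom a x -> lift_atom a (x + lattice R k).
Proof. by move=> [l hl]; exists (l + k); rewrite latticeD opprD addrACA subrr addr0. Qed.

(** Atoms lie in the open fundamental box, so two lattice translates of x in atoms differ by less
    than the periods and are equal. *)
Lemma lift_atom_uniq a b x : lift_atom a x -> lift_atom b x -> a = b.
Proof.
move=> [k ha] [l hb]; suff kl : k = l by move: hb; rewrite -kl; exact: atom_disjoint.
apply/subr0_eq; have [a1 a2] := atom_box ha; have [b1 b2] := atom_box hb.
rewrite /= in a1 a2 b1 b2.
by apply: (@lattice_small R); rewrite latticeB /= ltr_norml; lra.
Qed.

(* The vectors [gval2 z] and [gconj2 z] control the position [nproj z]. *)
Lemma reach (K : R) : exists N : nat, forall z (P : R * R) n,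
  `|gval R z.1 - P.1| <= 1 -> `|gval R z.2 - P.2| <= 1 ->
  `|gconj R z.1 - (phys P (- n)).1| <= K -> `|gconj R z.2 - (phys P (- n)).2| <= K ->
  (l1norm (nproj z - n)%R <= N)%N.
Proof.
have p1 := phi_gt R; have p2 := phi_lt R.
exists (Num.bound (10 * K + 20)) => z P n.
have e1 := congr1 fst (phys_vertex R z); have e2 := congr1 snd (phys_vertex R z).
rewrite -[gconj R z.1]e1 -[gconj R z.2]e2 {e1 e2} /phys /= => h1 h2.
set r1 := (X in `|X| <= K -> _); set r2 := (X in _ -> `|X| <= K -> _).
set m := nproj z in r1 r2 *.
have e1 : r1 = (gval R z.1 - P.1) - (3 - phi) * ((gval R z.1 - P.1) - (m.1 - n.1)%:~R) +
    (13 - 6 * phi) / 11 * ((gval R z.2 - P.2) - (m.2 - n.2)%:~R).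
  by rewrite /r1 !intrN !intrB; ring.
have e2 : r2 = (gval R z.2 - P.2) - (7 * phi - 6) / 11 * ((gval R z.2 - P.2) - (m.2 - n.2)%:~R).
  by rewrite /r2 !intrN !intrB; ring.
clearbody r1 r2.
have -> : l1norm (m - n) = (`|m.1 - n.1| + `|m.2 - n.2|)%N by [].
move: (m.1 - n.1) (m.2 - n.2) h1 h2 e1 e2 => x y.
move: (gval R z.1 - P.1) (gval R z.2 - P.2) => d1 d2.
rewrite -(ler_nat R) natrD !natr_absz !intr_norm.
set X : R := x%:~R; set Y : R := y%:~R; move: X Y => X Y h1 h2 e1 e2 k1 k2.
have K0 : 0 <= K by apply: le_trans k1.
apply: ltW; apply: le_lt_trans (archi_boundP _); last by lra.
rewrite !ler_norml in h1 h2 k1 k2.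
(* The system is triangular: the second equation involves only Y, with a coefficient above 0.48, and
   the first then bounds X. *)
have y1 : `|Y| <= 3 * K + 4.
  by rewrite ler_norml; apply/andP; split; nra.
have x1 : `|X| <= 3 * K + 4.
  by rewrite !ler_norml in y1 *; apply/andP; split; nra.
lra.
Qed.

Lemma sat_perturb Q (x r : R * R) : sat Q x -> exists2 t0 : R, 0 < t0 &
  forall t, `|t| < t0 -> sat Q (x.1 + t * r.1, x.2 + t * r.2).
Proof.
elim: Q => [|h Q IH] /=; first by exists 1.
move=> /andP[hx /IH[t1 t10 ht1]].
have [k hk] : exists k : R, forall t, slack h (x.1 + t * r.1, x.2 + t * r.2) = slack h x + t * k.
  rewrite /slack; case: h.1.2; [exists (form h.1.1 r)|exists (- form h.1.1 r)] => t;
  by rewrite form_comb; ring.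
have q0 : 0 < 1 + `|k| by rewrite ltr_pwDl.
exists (Num.min t1 (slack h x / (1 + `|k|))); first by rewrite lt_min t10 divr_gt0.
move=> t; rewrite lt_min => /andP[/ht1 -> ]; rewrite (ltr_pdivlMr _ _ q0) andbT hk => ht.
have : `|t * k| < slack h x by rewrite normrM; have := normr_ge0 t; nra.
by rewrite ltr_norml; lra.
Qed.

Lemma triangle_atom (x : R * R) :
  in_atom 2 x = [&& 0 < x.1, 2 < x.2 - phi * x.1 - x.1 & x.2 - phi * x.1 < 1 + phi].
Proof.
have pp := phi2 R.
have F2E (a b : R) : b - phi * (phi * a) = b - phi * a - a by rewrite mulrA pp; ring.
have -> : in_atom 2 x = sat [:: (D2, true, (2, 0)); (D1, false, (1, 1)); (DX, true, (0, 0))] x.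
  by rewrite /in_atom -[RHS]orbF.
rewrite /sat /= /slack /= /gval /= F2E !subr_gt0 !(mul0r, mul1r, addr0, andbT).
by apply/and3P/and3P => -[h1 h2 h3]; split.
Qed.

Lemma triangle_bounds (x : R * R) : in_atom 2 x -> 0 < x.1 < 62 / 100 /\ 2 < x.2 < 363 / 100.
Proof.
have p1 := phi_gt R; have p2 := phi_lt R.
by rewrite triangle_atom => /and3P[h1 h2 h3]; split; nra.
Qed.

(** The reference point has x = t and D2-value 2 + t: it is inside atom 2, close to both edges at
    the vertex (0, 2). [near_vertex2] does the same at (phi^-1, phi + 2). *)
Lemma near_vertex1 (x : R * R) t : 0 < t <= 1 / 100 ->
  `|x.1 - t| < t / 4 -> `|x.2 - (2 + t + phi * t + t)| < t / 4 ->
  in_atom 2 x /\ x.2 - phi * x.1 - x.1 < 2 + 2 * t.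
Proof.
move=> ht; have p1 := phi_gt R; have p2 := phi_lt R.
rewrite triangle_atom !ltr_norml; set d := x.1 - t => h1 h2.
have hd : - (t / 2) < phi * d < t / 2 by nra.
have e1 : phi * x.1 = phi * d + phi * t by rewrite /d; ring.
rewrite e1; have -> : x.1 = d + t by rewrite /d subrK.
by split; [apply/and3P; split|]; nra.
Qed.

Lemma near_vertex2 (x : R * R) t : 0 < t <= 1 / 100 ->
  `|x.1 - (phi - 1 - 2 * t)| < t / 4 ->
  `|x.2 - (1 + phi - t + phi * (phi - 1 - 2 * t))| < t / 4 ->
  in_atom 2 x /\ 1 + phi - 2 * t < x.2 - phi * x.1.
Proof.
move=> ht; have p1 := phi_gt R; have p2 := phi_lt R.
rewrite triangle_atom !ltr_norml; set v := phi - 1 - 2 * t; set d := x.1 - v => h1 h2.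
have hd : - (t / 2) < phi * d < t / 2 by nra.
have e1 : phi * x.1 = phi * d + phi * v by rewrite /d; ring.
have e2 : x.1 = d + v by rewrite /d subrK.
by rewrite e1 e2 /v in h2 *; split; [apply/and3P; split|]; lra.
Qed.

(** The three half-planes are parallel to the sides of atom 2 and bound a triangle of size
    proportional to t; in particular r is the difference of the D1- and D2-values. *)
Lemma pinch (r s : R) t : 0 < t -> - (2 * t) < r -> - (2 * t) < s - phi * r - r ->
  s - phi * r < 2 * t -> `|r| < 20 * t /\ `|s| < 20 * t.
Proof.
move=> t0; have p1 := phi_gt R; have p2 := phi_lt R; rewrite !ltr_norml => h1 h2 h3.
have h4 : r < 4 * t by lra.
have h5 : - (4 * t) < phi * r < 8 * t by nra.
by split; lra.
Qed.

(* Place p inside atom 2 near two of its vertices; then q lies in the same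
   translate of the triangle both times, which pins q - p down. *)
Lemma closeness (e : R) : 0 < e -> exists N : nat, forall p q : R * R,
  (forall k, (l1norm k <= N)%N -> exists2 a, lift_atom a (p + intvec k) & lift_atom a (q + intvec k)) ->
  exists g, sup_close e q (p + lattice R g).
Proof.
move=> e0; have p1 := phi_gt R; have p2 := phi_lt R; have pp := phi2 R.
pose eta := Num.min (e / 20) (1 / 100).
have eta0 : 0 < eta by rewrite lt_min; lra.
have [eta1 eta2] : eta <= e / 20 /\ eta <= 1 / 100.
  by apply/andP; rewrite -le_min.
have d0 : 0 < eta / 4 by lra.
have [K K0 hK] := zphi_dense d0.
have [N hN] := reach K; exists N => p q hpq.
have place (v : R * R) : exists z, [/\ `|p.1 + gval R z.1 - v.1| < eta / 4,
    `|p.2 + gval R z.2 - v.2| < eta / 4 & (l1norm (nproj z) <= N)%N].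
  have [z1 [a1 b1]] := hK (v.1 - p.1) (phys (v - p) (- 0)).1.
  have [z2 [a2 b2]] := hK (v.2 - p.2) (phys (v - p) (- 0)).2.
  exists (z1, z2); rewrite /= (_ : p.1 + gval R z1 - v.1 = gval R z1 - (v.1 - p.1)); last by ring.
  rewrite (_ : p.2 + gval R z2 - v.2 = gval R z2 - (v.2 - p.2)); last by ring.
  split=> //; rewrite -[nproj _]subr0; apply: (hN _ (v - p)) => //=.
    by apply: ltW; apply: lt_le_trans a1 _; lra.
  by apply: ltW; apply: lt_le_trans a2 _; lra.
(* Translation by z is, modulo the lattice, the position [nproj z], where q has the same letter as
   p. *)
have move_ z : in_atom 2 (p + gval2 R z) -> (l1norm (nproj z) <= N)%N ->
    exists g, in_atom 2 (q + gval2 R z - lattice R g).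
  move=> hz /hpq[a]; rewrite gval2_split !addrA in hz *.
  have h2 : lift_atom 2 (p + intvec (nproj z)).
    by exists (- lattice_index z); rewrite latticeN opprK.
  move=> /(lift_atom_uniq h2) <- [l hl]; exists (l + lattice_index z).
  by rewrite latticeD opprD addrACA subrr addr0.
have [z1 [x1 y1 l1]] := place (eta, 2 + eta + phi * eta + eta).
have [z2 [x2 y2 l2]] := place (phi - 1 - 2 * eta, 1 + phi - eta + phi * (phi - 1 - 2 * eta)).
have et : 0 < eta <= 1 / 100 by rewrite eta0.
have [h1 f1] := @near_vertex1 (p + gval2 R z1) _ et x1 y1.
have [h2 f2] := @near_vertex2 (p + gval2 R z2) _ et x2 y2.
have [g1 k1] := move_ z1 h1 l1; have [g2 k2] := move_ z2 h2 l2.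
(* Atom 2 is less than 0.62 wide and 1.63 high, so both lattice vectors are within that of q - p and
   their difference is smaller than the periods. *)
have g12 : g1 = g2.
  have [a1 b1] := triangle_bounds h1; have [a2 b2] := triangle_bounds h2.
  have [c1 d1] := triangle_bounds k1; have [c2 d2] := triangle_bounds k2.
  rewrite /= in a1 b1 a2 b2 c1 d1 c2 d2.
  clear -p1 p2 a1 b1 a2 b2 c1 d1 c2 d2.
  by apply/subr0_eq; apply: (@lattice_small R); rewrite latticeB /= ltr_norml; lra.
exists g1.
move: k1 k2; rewrite -g12 !triangle_atom /= => /and3P[b1 b2 _] /and3P[_ _ c3].
have -> : sup_close e q (p + lattice R g1) =
    (`|q.1 - p.1 - (lattice R g1).1| < e /\ `|q.2 - p.2 - (lattice R g1).2| < e).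
  by rewrite /sup_close /= !opprD !addrA.
(* The first vertex bounds x and the D2-value of the difference from below; the second bounds its
   D1-value from above. *)
have [r1 r2] : `|q.1 - p.1 - (lattice R g1).1| < 20 * eta /\ `|q.2 - p.2 - (lattice R g1).2| < 20 * eta.
  rewrite /= !ltr_norml in f1 f2 x1; clear -p1 p2 b1 b2 c3 f1 f2 eta0 x1.
  by apply: pinch => //=; lra.
by split; [apply: lt_le_trans r1 _|apply: lt_le_trans r2 _]; lra.
Qed.

Lemma close_sym (e : R) x y : sup_close e x y -> sup_close e y x.
Proof. by rewrite /sup_close !(distrC y.1) !(distrC y.2). Qed.

Lemma close_trans (e f : R) x y z : sup_close e x y -> sup_close f y z -> sup_close (e + f) x z.
Proof.
move=> [a1 a2] [b1 b2]; split.
  by rewrite -(subrKA y.1); apply: le_lt_trans (ler_normD _ _) _; rewrite ltrD.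
by rewrite -(subrKA y.2); apply: le_lt_trans (ler_normD _ _) _; rewrite ltrD.
Qed.

Lemma close_add (e : R) x y v : sup_close e x y -> sup_close e (x + v) (y + v).
Proof.
have E (a b c : R) : a + c - (b + c) = a - b by ring.
by rewrite /sup_close /= !E.
Qed.

Lemma close_lattice_uniq (e : R) x y k l : e <= 1 / 2 ->
  sup_close e x (y + lattice R k) -> sup_close e x (y + lattice R l) -> k = l.
Proof.
move=> e1 /close_sym h1 h2; have [a1 a2] := close_trans h1 h2.
have p1 := phi_gt R; have E (a b c : R) : a + b - (a + c) = b - c by ring.
rewrite /= !E in a1 a2; apply/subr0_eq; apply: (@lattice_small R); rewrite latticeB /=.
  by apply: lt_trans a1 _; lra.
by apply: lt_trans a2 _; lra.
Qed.

(** The lattice translations between neighbours are unique, hence commute around unit squares, and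
    [plane_potential] integrates them. Diagonal neighbours take two steps, whence e + e. *)
Lemma lift_family (p : Z2 -> R * R) (e : R) : e <= 1 / 4 ->
  (forall n m, near_index n m -> exists g, sup_close e (p m) (p n + lattice R g)) ->
  exists G : Z2 -> Z2, forall n m, near_index n m ->
    sup_close (e + e) (p m + lattice R (G m)) (p n + lattice R (G n)).
Proof.
move=> e1 h.
have near1 i j : near_index (i, j) (i + 1, j).
  by apply: near_indexD; rewrite /= ?subrr // addrC addKr.
have near2 i j : near_index (i, j) (i, j + 1).
  by apply: near_indexD; rewrite /= ?subrr // addrC addKr.
have /choice[f1 hf1] : forall n : Z2, exists g, sup_close e (p (n.1 + 1, n.2)) (p n + lattice R g).
  by case=> i j; exact: h (near1 i j).
have /choice[f2 hf2] : forall n : Z2, exists g, sup_close e (p (n.1, n.2 + 1)) (p n + lattice R g).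
  by case=> i j; exact: h (near2 i j).
(* Both sums translate [p (i, j)] to within 2e <= 1/2 of [p (i + 1, j + 1)]. *)
have comm i j : f1 (i, j) + f2 (i + 1, j) = f2 (i, j) + f1 (i, j + 1).
  apply: (@close_lattice_uniq (e + e) (p (i + 1, j + 1)) (p (i, j))); first lra.
    rewrite latticeD addrA; apply: close_trans (hf2 (i + 1, j)) _.
    exact: close_add (hf1 (i, j)).
  rewrite latticeD addrA; apply: close_trans (hf1 (i, j + 1)) _.
  exact: close_add (hf2 (i, j)).
have [G1 hG1] := @plane_potential (fun i j => - (f1 (i, j)).1) (fun i j => - (f2 (i, j)).1)
  (fun i j => ltac:(by rewrite -!opprD; congr (- _); exact: (congr1 fst (comm i j)))).
have [G2 hG2] := @plane_potential (fun i j => - (f1 (i, j)).2) (fun i j => - (f2 (i, j)).2)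
  (fun i j => ltac:(by rewrite -!opprD; congr (- _); exact: (congr1 snd (comm i j)))).
pose u n := p n + lattice R (G1 n.1 n.2, G2 n.1 n.2).
have s1 i j : sup_close e (u (i + 1, j)) (u (i, j)).
  have := close_add (lattice R (G1 (i + 1) j, G2 (i + 1) j)) (hf1 (i, j)).
  rewrite -addrA -latticeD; congr (sup_close _ _ (_ + lattice R _)).
  by apply: zphi_eq; rewrite /= ?(hG1 i j).1 ?(hG2 i j).1; ring.
have s2 i j : sup_close e (u (i, j + 1)) (u (i, j)).
  have := close_add (lattice R (G1 i (j + 1), G2 i (j + 1))) (hf2 (i, j)).
  rewrite -addrA -latticeD; congr (sup_close _ _ (_ + lattice R _)).
  by apply: zphi_eq; rewrite /= ?(hG1 i j).2 ?(hG2 i j).2; ring.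
have e0 : 0 < e by apply: le_lt_trans (s1 0 0).1.
have refl x : sup_close e x x by rewrite /sup_close !subrr normr0.
have hor i i' j : `|i' - i| <= 1 -> sup_close e (u (i', j)) (u (i, j)).
  move=> hi; have [->|[->|->]] : i' = i \/ i' = i + 1 \/ i = i' + 1 by clear -hi; lia.
  - exact: refl.
  - exact: s1.
  - exact/close_sym/s1.
have ver i j j' : `|j' - j| <= 1 -> sup_close e (u (i, j')) (u (i, j)).
  move=> hi; have [->|[->|->]] : j' = j \/ j' = j + 1 \/ j = j' + 1 by clear -hi; lia.
  - exact: refl.
  - exact: s2.
  - exact/close_sym/s2.
exists (fun n => (G1 n.1 n.2, G2 n.1 n.2)) => -[i j] [i' j'] /andP[/= hi hj].
exact: close_trans (ver i' j j' hj) (hor i i' j hi).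
Qed.

(* For each form, the centre of a disc of radius 1/10 meeting exactly two atoms,
   separated by a line of that form. *)
Definition center (d : dir) : R * R :=
  match d with
  | DX => (phi - 1, 1 / 2)
  | DY => ((phi - 1) / 2, 1)
  | D1 => ((phi - 1) / 2, 1 / 2)
  | D2 => (phi / 2, 1 / 2)
  end.
Definition center_val (d : dir) : zphi :=
  match d with DX => (-1, 1) | DY => (1, 0) | D1 => (0, 0) | D2 => (0, -1) end.
Definition side_atom (d : dir) (b : bool) : nat :=
  match d with DY => if b then 9 else 1 | _ => if b then 1 else 0 end.

Lemma center_on_line d : form d (center d) = gval R (center_val d).
Proof. by have pp := phi2 R; case: d; rewrite /gval /=; field: pp. Qed.

Lemma atomI a Q (x : R * R) : Q \in pieces a -> sat Q x -> in_atom a x.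
Proof. by move=> hQ hs; apply/hasP; exists Q. Qed.

Lemma center_sides d (x : R * R) : sup_close (1 / 10) x (center d) ->
  (gval R (center_val d) < form d x -> in_atom (side_atom d true) x) /\
  (form d x < gval R (center_val d) -> in_atom (side_atom d false) x).
Proof.
have p1 := phi_gt R; have p2 := phi_lt R; have pp := phi2 R.
have F2E (a b : R) : b - phi * (phi * a) = b - phi * a - a by rewrite mulrA pp; ring.
rewrite /sup_close !ltr_norml; case: d => /= -[hx hy]; split => h.
- apply: (@atomI _ [:: (D2, true, (0, -1)); (DY, false, (1, 0)); (DX, true, (-1, 1))]) => //.
  by rewrite /sat /= /slack /gval /= ?F2E in h *; apply/and4P; split=> //; nra.
- apply: (@atomI _ [:: (DY, true, (0, 0)); (DX, false, (-1, 1)); (D1, false, (0, 0))]) => //.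
  by rewrite /sat /= /slack /gval /= ?F2E in h *; apply/and4P; split=> //; nra.
- apply: (@atomI _ [:: (DY, true, (1, 0)); (DX, false, (-1, 1)); (D1, false, (1, 0))]) => //.
  by rewrite /sat /= /slack /gval /= ?F2E in h *; apply/and4P; split=> //; nra.
- apply: (@atomI _ [:: (D1, true, (0, 0)); (DY, false, (1, 0)); (DX, true, (0, 0))]) => //.
  by rewrite /sat /= /slack /gval /= ?F2E in h *; apply/and4P; split=> //; nra.
- apply: (@atomI _ [:: (D1, true, (0, 0)); (DY, false, (1, 0)); (DX, true, (0, 0))]) => //.
  by rewrite /sat /= /slack /gval /= ?F2E in h *; apply/and4P; split=> //; nra.
- apply: (@atomI _ [:: (DY, true, (0, 0)); (DX, false, (-1, 1)); (D1, false, (0, 0))]) => //.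
  by rewrite /sat /= /slack /gval /= ?F2E in h *; apply/and4P; split=> //; nra.
- apply: (@atomI _ [:: (D2, true, (0, -1)); (DY, false, (1, 0)); (DX, true, (-1, 1))]) => //.
  by rewrite /sat /= /slack /gval /= ?F2E in h *; apply/and4P; split=> //; nra.
- apply: (@atomI _ [:: (DY, true, (0, 0)); (DX, false, (1, 0)); (D2, false, (0, -1))]) => //.
  by rewrite /sat /= /slack /gval /= ?F2E in h *; apply/and4P; split=> //; nra.
Qed.

Definition normal_dir (d : dir) : R * R := if d is DX then (1, 0) else (0, 1).

Lemma form_normal d : form d (normal_dir d) = 1.
Proof. by case: d => //=; rewrite !mulr0 subr0. Qed.

(** Atoms are open, so small moves to both sides of the line would stay in atom a, while the two
    sides belong to different atoms. *)
Lemma boundary_not_atom d (x : R * R) a : sup_close (1 / 10) x (center d) ->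
  form d x = gval R (center_val d) -> ~ lift_atom a x.
Proof.
move=> hc hd [k /hasP[Q hQ hs]].
have [t0 t00 ht] := sat_perturb (normal_dir d) hs.
have [t1 t10 ht1] : exists2 t1 : R, 0 < t1 & forall t, `|t| <= t1 ->
    sup_close (1 / 10) (x.1 + t * (normal_dir d).1, x.2 + t * (normal_dir d).2) (center d).
  move: hc => [h1 h2].
  exists (Num.min (1 / 10 - `|x.1 - (center d).1|) (1 / 10 - `|x.2 - (center d).2|) / 2).
    by rewrite divr_gt0// lt_min !subr_gt0 h1.
  move=> t; set m := Num.min _ _ => hm.
  have [m1 m2] : m <= 1 / 10 - `|x.1 - (center d).1| /\ m <= 1 / 10 - `|x.2 - (center d).2|.
    by apply/andP; rewrite -le_min.
  have m0 : 0 < m by rewrite lt_min !subr_gt0 h1.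
  have tri (v b : R) : `|v| + m / 2 < 1 / 10 -> `|b| <= 1 -> `|v + t * b| < 1 / 10.
    move=> ha hb; apply: le_lt_trans ha; apply: le_trans (ler_normD _ _) _.
    by rewrite lerD2l normrM; have := normr_ge0 t; nra.
  have nb : `|(normal_dir d).1| <= 1 /\ `|(normal_dir d).2| <= 1.
    by case: (d) => /=; rewrite ?normr0 ?normr1.
  by rewrite /sup_close /= !(addrAC _ (_ * _)); split; apply: tri; lra.
pose t := Num.min t0 t1 / 2.
have [k0 k1] : Num.min t0 t1 <= t0 /\ Num.min t0 t1 <= t1 by apply/andP; rewrite -le_min.
have kp : 0 < Num.min t0 t1 by rewrite lt_min t00.
have side (s : R) : `|s| = t -> sup_close (1 / 10) (x.1 + s * (normal_dir d).1, x.2 + s * (normal_dir d).2) (center d)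
   /\ lift_atom a (x.1 + s * (normal_dir d).1, x.2 + s * (normal_dir d).2).
  move=> hst; split; first by apply: ht1; rewrite hst /t; lra.
  exists k; apply/hasP; exists Q => //; have := ht s; rewrite hst => /(_ ltac:(rewrite /t; lra)).
  by congr (sat Q _); congr pair => /=; rewrite addrAC.
have tp : 0 < t by rewrite /t; lra.
have [cp lp] := side t (gtr0_norm tp); have [cn ln] := side (- t) ltac:(by rewrite normrN gtr0_norm).
have vp := (center_sides cp).1; rewrite form_comb form_normal hd in vp.
have vn := (center_sides cn).2; rewrite form_comb form_normal hd in vn.
have e1 := lift_atom_uniq lp (in_atom_lift (vp ltac:(lra))).
have e2 := lift_atom_uniq ln (in_atom_lift (vn ltac:(lra))).
by move: e2; rewrite e1; case: (d).
Qed.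

Lemma same_side d (x y : R * R) a : sup_close (1 / 10) x (center d) -> sup_close (1 / 10) y (center d) ->
  lift_atom a x -> lift_atom a y ->
  form d x != gval R (center_val d) /\
  (gval R (center_val d) < form d x) = (gval R (center_val d) < form d y).
Proof.
move=> cx cy lx ly.
have decide z : sup_close (1 / 10) z (center d) -> lift_atom a z ->
    form d z != gval R (center_val d) /\ (gval R (center_val d) < form d z) = (a == side_atom d true).
  move=> cz lz; have [s1 s2] := center_sides cz.
  have [hlt|hgt|heq] := ltgtP (gval R (center_val d)) (form d z).
  - by split=> //; rewrite (lift_atom_uniq lz (in_atom_lift (s1 hlt))) eqxx.
  - split=> //; rewrite (lift_atom_uniq lz (in_atom_lift (s2 hgt))).
    by apply/esym/negbTE; case: (d).
  - by case: (boundary_not_atom cz (esym heq) lz).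
have [nx ->] := decide x cx lx; have [_ ->] := decide y cy ly.
by [].
Qed.

Lemma formB d (x y : R * R) : form d (x - y) = form d x - form d y.
Proof. by case: d => /=; ring. Qed.
Lemma formD d (x y : R * R) : form d (x + y) = form d x + form d y.
Proof. by case: d => /=; ring. Qed.
Lemma formcB d (x y : R * R) : formc d (x - y) = formc d x - formc d y.
Proof. by case: d => /=; ring. Qed.
Lemma physB (x y : R * R) n m : phys (x - y) (n - m) = phys x n - phys y m.
Proof. by rewrite /phys /= !intrB; congr pair => /=; ring. Qed.

Lemma l1norm_triangle (n m : Z2) : (l1norm (n + m)%R <= l1norm n + l1norm m)%N.
Proof. by rewrite /l1norm /=; lia. Qed.

Lemma near_l1norm (n m : Z2) : near_index n m -> (l1norm (m - n)%R <= 2)%N.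
Proof. by move=> /andP[]; rewrite /l1norm /=; lia. Qed.

Lemma formc_small d (x : R * R) (K : R) : `|x.1| <= K -> `|x.2| <= K -> `|formc d x| <= 2 * K.
Proof.
have p1 := phi_gt R; have p2 := phi_lt R; rewrite !ler_norml => h1 h2.
have K0 : 0 <= K by lra.
case: d => /=; try (apply/andP; split; lra).
- have : - K <= (phi - 1) * x.1 <= K by apply/andP; split; nra.
  lra.
- have -> : (1 - phi) * ((1 - phi) * x.1) = (2 - phi) * x.1 by ring: (phi2 R).
  have : - K <= (2 - phi) * x.1 <= K by apply/andP; split; nra.
  lra.
Qed.

Lemma phys_small (x : R * R) (K : R) : `|x.1| <= K -> `|x.2| <= K ->
  `|(phys x 0).1| <= 2 * K /\ `|(phys x 0).2| <= 2 * K.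
Proof.
have p1 := phi_gt R; have p2 := phi_lt R; rewrite /phys /= !addr0 !ler_norml => h1 h2.
have -> : x.1 - (3 - phi) * x.1 + (13 - 6 * phi) / 11 * x.2 =
  - ((2 - phi) * x.1) + (13 - 6 * phi) / 11 * x.2 by ring.
have -> : x.2 - (7 * phi - 6) / 11 * x.2 = (17 - 7 * phi) / 11 * x.2 by field.
have a1 : - K <= (2 - phi) * x.1 <= K by apply/andP; split; nra.
have a2 : - K <= (13 - 6 * phi) / 11 * x.2 <= K by apply/andP; split; nra.
have a3 : - K <= (17 - 7 * phi) / 11 * x.2 <= K by apply/andP; split; nra.
by split; lra.
Qed.

Lemma center_conj d : `|gconj R (center_val d) - formc d (phys (center d) 0)| <= 10.
Proof.
have p1 := phi_gt R; have p2 := phi_lt R.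
have c1 : `|(center d).1| <= 1 by rewrite ler_norml; case: (d) => /=; lra.
have c2 : `|(center d).2| <= 1 by rewrite ler_norml; case: (d) => /=; lra.
have [t1 t2] := phys_small c1 c2; have := formc_small d t1 t2.
rewrite !ler_norml; have : -2 <= gconj R (center_val d) <= 2.
  by clear t1 t2 c1 c2; case: (d); rewrite /gconj /=; lra.
lra.
Qed.

Lemma form_control d (v : R * R) : `|form d v| <= 1 / 25 ->
  `|if d is DX then v.2 else v.1| < 1 / 100 -> `|v.1| < 9 / 100 /\ `|v.2| < 9 / 100.
Proof.
have p1 := phi_gt R; have p2 := phi_lt R; have pp := phi2 R.
case: v => b e; rewrite !(ltr_norml, ler_norml); case: d => /= h1 h2; try by split; lra.
- have : - (2 / 100) < phi * b < 2 / 100 by nra.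
  by split; lra.
- have : - (3 / 100) < phi * (phi * b) < 3 / 100 by rewrite mulrA pp; nra.
  by split; lra.
Qed.

Lemma formc_control d (v : R * R) (K : R) : `|formc d v| <= 50 ->
  `|if d is DX then v.2 else v.1| <= K -> `|v.1| <= K + 60 /\ `|v.2| <= K + 60.
Proof.
have p1 := phi_gt R; have p2 := phi_lt R; have pp := phi2 R.
case: v => b e; rewrite !ler_norml; case: d => /= h1 h2; try by split; lra.
- have : - K <= (phi - 1) * b <= K by nra.
  by split; lra.
- have hb : (1 - phi) * ((1 - phi) * b) = (2 - phi) * b by ring: pp.
  have : - K <= (2 - phi) * b <= K by nra.
  by rewrite hb in h1; split; lra.
Qed.

(** When x is near the line and n is in its strip, a vertex z moves the line onto the test line
    through [center d] and x into the test disc, while [nproj z] stays at bounded distance from n.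
    The letter there thus shows the side of x. *)
Lemma visible_vertex : exists N : nat, forall (x : R * R) n d c,
  `|form d x - gval R c| <= 1 / 25 -> `|formc d (phys x n) - gconj R c| <= 40 ->
  exists z, [/\ formz d z = center_val d - c, sup_close (9 / 100) (x + gval2 R z) (center d) &
    (l1norm (nproj z - n)%R <= N)%N].
Proof.
have p1 := phi_gt R; have p2 := phi_lt R; have pp := phi2 R.
have d0 : 0 < 1 / 100 :> R by lra.
have [K K0 hK] := zphi_dense d0; have [N hN] := reach (K + 60).
exists N => x n d c hx hy.
pose P := center d - x; pose T := phys P (- n).
have hT : T = phys (center d) 0 - phys x n by rewrite /T -sub0r physB.
(* zeta is the free coordinate along the line, chosen by value and conjugate; the other coordinate
   of z is forced by [formz d z]. *)
have [zeta [hz1 hz2]] := hK (if d is DX then P.2 else P.1) (if d is DX then T.2 else T.1).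
pose z : zphi * zphi := match d with
  | DX => (center_val d - c, zeta)
  | DY => (zeta, center_val d - c)
  | D1 => (zeta, center_val d - c + gphi zeta)
  | D2 => (zeta, center_val d - c + gphi (gphi zeta)) end.
have hz : formz d z = center_val d - c by rewrite /z; case: (d); rewrite //= addrK.
have l1 : form d (gval2 R z - P) = form d x - gval R c.
  by rewrite formB form_gval hz gvalB /P formB center_on_line; ring.
have l2 : formc d (gconj2 R z - T) =
    (gconj R (center_val d) - formc d (phys (center d) 0)) + (formc d (phys x n) - gconj R c).
  by rewrite formcB formc_gconj hz gconjB hT formcB; ring.
have {}hx : `|form d (gval2 R z - P)| <= 1 / 25 by rewrite l1.
have {}hy : `|formc d (gconj2 R z - T)| <= 50.
  rewrite l2; apply: le_trans (ler_normD _ _) _.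
  by have := center_conj d; lra.
have [cz1 cz2] := form_control hx (ltac:(by move: hz1; rewrite /z; case: (d))).
have [cz3 cz4] := @formc_control d (gconj2 R z - T) K hy (ltac:(by move: hz2; rewrite /z; case: (d))).
exists z; split=> //.
  have E1 : (x + gval2 R z).1 - (center d).1 = (gval2 R z - P).1 by rewrite /P /=; ring.
  have E2 : (x + gval2 R z).2 - (center d).2 = (gval2 R z - P).2 by rewrite /P /=; ring.
  by rewrite /sup_close E1 E2.
apply: (hN z P n) => //; apply: ltW; [apply: lt_trans cz1 _|apply: lt_trans cz2 _]; lra.
Qed.

(** Far from the line, the drift from n to m cannot cross it. Near it, [visible_vertex] brings both
    points into the test disc, where they share a letter. The radius gains 2 because m is within
    distance 2 of n. *)
Lemma side_constant : exists N : nat, forall (w : Z2 -> nat) (u : Z2 -> R * R),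
  (forall n m, near_index n m -> sup_close (1 / 100) (u m) (u n)) ->
  (forall n j, (l1norm (j - n)%R <= N)%N -> lift_atom (w j) (u n + intvec j)) ->
  forall d c n m, near_index n m -> `|formc d (phys (u n) n) - gconj R c| <= 40 ->
  form d (u n) != gval R c /\ (gval R c < form d (u n)) = (gval R c < form d (u m)).
Proof.
have [N hN] := visible_vertex; exists (N + 2)%N => w u slow hw d c n m nm hs.
have [s1 s2] := slow n m nm.
(* The largest drift is that of D2, at most (1 + phi^2)/100 < 1/25. *)
have hd : `|form d (u m) - form d (u n)| < 1 / 25.
  have p1 := phi_gt R; have p2 := phi_lt R; have pp := phi2 R.
  rewrite -formB; move: s1 s2; rewrite !ltr_norml.
  have -> : (u m).1 - (u n).1 = (u m - u n).1 by [].
  have -> : (u m).2 - (u n).2 = (u m - u n).2 by [].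
  case: (u m - u n) => a b; clear -p1 p2 pp; case: (d) => /= h1 h2; try lra.
  - have : - (2 / 100) < phi * a < 2 / 100 by nra.
    lra.
  - have : - (27 / 1000) < phi * (phi * a) < 27 / 1000 by rewrite mulrA pp; nra.
    lra.
have [hfar|hx] := ltP (1 / 25) `|form d (u n) - gval R c|.
  move: hd; rewrite ltr_norml => hd; have [hlt|hgt|heq] := ltgtP (gval R c) (form d (u n)).
  - by split=> //; apply/esym; move: hfar; rewrite gtr0_norm; lra.
  - by split=> //; apply/esym/negbTE; move: hfar; rewrite -leNgt ltr0_norm; lra.
  - by exfalso; move: hfar; rewrite heq subrr normr0; lra.
have [z [hz cz lz]] := hN (u n) n d c hx hs.
have lift k : (l1norm (nproj z - k)%R <= N + 2)%N -> lift_atom (w (nproj z)) (u k + gval2 R z).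
  by move=> hk; rewrite gval2_split addrA; apply: lift_atom_lattice; exact: hw.
have ln := lift n (leq_trans lz (leq_addr _ _)).
have lm : lift_atom (w (nproj z)) (u m + gval2 R z).
  apply: lift; rewrite -(subrKA n); apply: leq_trans (l1norm_triangle _ _) _.
  by apply: leq_add => //; apply: near_l1norm; move: nm; rewrite /near_index !(distrC m.1) !(distrC m.2).
have cm : sup_close (1 / 10) (u m + gval2 R z) (center d).
  have := close_trans (close_add (gval2 R z) (slow n m nm)) cz.
  by rewrite (_ : 1 / 100 + 9 / 100 = 1 / 10 :> R) //; field.
have cn : sup_close (1 / 10) (u n + gval2 R z) (center d).
  by have [h1 h2] := cz; split; [apply: lt_trans h1 _|apply: lt_trans h2 _]; lra.
have [k1 k2] := same_side cn cm ln lm.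
move: k1 k2; rewrite !formD form_gval hz gvalB.
have E (a : R) : a + (gval R (center_val d) - gval R c) - gval R (center_val d) = a - gval R c by ring.
by rewrite -subr_eq0 -!(subr_gt0 (gval R (center_val d))) !E !subr_gt0 subr_eq0.
Qed.

Lemma pieces_conj_bound a Q h : Q \in pieces a -> h \in Q -> `|gconj R h.2| <= 10.
Proof.
have p1 := phi_gt R; have p2 := phi_lt R.
move=> hQ hh; have ha := piece_index hQ.
have hb : all (fun Q => all (fun h : constr => (`|h.2.1| <= 5) && (`|h.2.2| <= 5)) Q) all_pieces.
  by vm_compute.
have hQ' : Q \in all_pieces by apply/flatten_mapP; exists a => //; rewrite mem_iota.
have /andP[b1 b2] := allP (allP hb Q hQ') h hh.
rewrite -(ler_int R) intr_norm ler_norml in b1; rewrite -(ler_int R) intr_norm ler_norml in b2.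
by rewrite /gconj ler_norml; apply/andP; split; nra.
Qed.

(** The points of neighbouring windows agree up to 1/200 modulo the lattice and lift to a slowly
    varying family. [pseudo_orbit] then gives one point on the same side, for every j in S, of the
    lines bounding the piece occupied at j. *)
Lemma shadowing : exists N : nat, forall w : Z2 -> nat,
  (forall n, exists x : R * R, forall k, (l1norm k <= N)%N -> lift_atom (w (k + n)) (x + intvec k)) ->
  forall S : seq Z2, exists p : R * R, forall j, j \in S -> lift_atom (w j) (p + intvec j).
Proof.
have p1 := phi_gt R; have p2 := phi_lt R.
have e0 : 0 < 1 / 200 :> R by lra.
have [N1 hN1] := closeness e0; have [N2 hN2] := side_constant.
exists (N1 + N2 + 2)%N => w /choice[x hx] S.
pose p n := x n - intvec n.
have nvD n m : intvec (n + m) = intvec n + intvec m by rewrite /intvec /= !intrD.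
have hp n j : (l1norm (j - n)%R <= N1 + N2 + 2)%N -> lift_atom (w j) (p n + intvec j).
  move=> /(hx n); rewrite subrK => h.
  have -> // : p n + intvec j = x n + intvec (j - n).
  by rewrite /p -[in LHS](subrK n j) [in LHS]nvD [X in _ + X]addrC addrA subrK.
have e4 : 1 / 200 <= 1 / 4 :> R by lra.
have [|G hG] := @lift_family p _ e4.
  move=> n m nm.
  have [|g hg] := hN1 (p n + intvec m) (p m + intvec m).
    move=> k hk; exists (w (k + m)); rewrite -addrA -nvD [m + k]addrC; apply: hp.
      rewrite -addrA; apply: leq_trans (l1norm_triangle _ _) _.
      by apply: leq_trans (leq_add hk (near_l1norm nm)) _; rewrite leq_add2r leq_addr.
    by rewrite addrK; apply: leq_trans hk _; rewrite -addnA leq_addr.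
  exists g; have := close_add (- intvec m) hg.
  by rewrite addrK -!addrA [lattice R g - _]addrC !addrA addrK.
pose u n := p n + lattice R (G n).
have slow n m : near_index n m -> sup_close (1 / 100) (u m) (u n).
  by move=> /hG; rewrite (_ : 1 / 200 + 1 / 200 = 1 / 100 :> R) //; field.
have hu n j : (l1norm (j - n)%R <= N2)%N -> lift_atom (w j) (u n + intvec j).
  move=> hj; rewrite /u addrAC; apply: lift_atom_lattice; apply: hp.
  by apply: leq_trans hj _; rewrite addnAC leq_addl.
have l0 j : (l1norm (j - j)%R <= N2)%N by rewrite subrr.
have /choice[gQ hgQ] : forall j, exists gQ : Z2 * seq constr,
    gQ.2 \in pieces (w j) /\ sat gQ.2 (u j + intvec j - lattice R gQ.1).
  by move=> j; have [g /hasP[Q hQ hs]] := hu j j (l0 j); exists (g, Q).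
(* Membership of [v + j] in a lattice translate of a piece becomes membership of [v - zj j] in the
   piece, which shifts each bounding line by [formz d (zj j)]. *)
pose zj j : zphi * zphi := latticez (gQ j).1 - ((j.1, 0), (j.2, 0)).
have zjE j : gval2 R (zj j) = lattice R (gQ j).1 - intvec j.
  by rewrite gval2B /intvec; congr (_ - _); rewrite /gval2 /gval /= !mul0r !addr0.
have zjn j : nproj (zj j) = - j.
  by apply: zphi_eq; rewrite /nproj /zj /latticez /=; ring.
pose L := flatten [seq [seq (h.1.1, h.2 + formz h.1.1 (zj j)) | h <- (gQ j).2] | j <- S].
have slow' n m : near_index n m -> `|(u m).1 - (u n).1| <= 1 / 100 /\ `|(u m).2 - (u n).2| <= 1 / 100.
  by move=> /slow[h1 h2]; split; exact: ltW.
have [q hq] := pseudo_orbit slow' (hN2 w u slow hu) L.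
exists q => j jS; have [hQ hs] := hgQ j; exists (gQ j).1; apply/hasP; exists (gQ j).2 => //.
have shift v : v + intvec j - lattice R (gQ j).1 = v - gval2 R (zj j).
  by rewrite zjE opprB addrA addrAC.
rewrite shift in hs; rewrite shift; apply/allP => h hh; have := allP hs h hh.
have hL : (h.1.1, h.2 + formz h.1.1 (zj j)) \in L.
  by apply/flatten_mapP; exists j => //; apply/mapP; exists h.
(* Position j sees the lines of its own piece: [formc] contributes at most 20, as the point is in
   the box, and the conjugate of the constant at most 10. *)
have hstrip : `|formc h.1.1 (phys (u j) j) - gconj R (h.2 + formz h.1.1 (zj j))| <= 40.
  have -> : formc h.1.1 (phys (u j) j) - gconj R (h.2 + formz h.1.1 (zj j)) =
      formc h.1.1 (phys (u j - gval2 R (zj j)) 0) - gconj R h.2.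
    have -> : (0 : Z2) = j - - nproj (zj j) by rewrite zjn opprK subrr.
    by rewrite physB phys_vertex formcB formc_gconj gconjD; ring.
  have [b1 b2] := piece_box hQ hs.
  have c1 : `|(u j - gval2 R (zj j)).1| <= 5 by rewrite ler_norml; lra.
  have c2 : `|(u j - gval2 R (zj j)).2| <= 5 by rewrite ler_norml; lra.
  have [t1 t2] := phys_small c1 c2; have := formc_small h.1.1 t1 t2.
  have := pieces_conj_bound hQ hh.
  move: (formc _ _) (gconj _ _) => a b h1 h2; apply: le_trans (ler_normB _ _) _; lra.
have [k1 k2] := hq _ hL j hstrip; rewrite /= !gvalD in k1 k2.
rewrite /slack !formB !form_gval; move: k1 k2.
move: (form _ (u j)) (form _ q) (gval R h.2) (gval R (formz _ _)) => a b c d k1 k2.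
case: h.1.2; rewrite !subr_gt0; first by rewrite !ltrBrDr k2.
rewrite !ltrBlDr => ha; rewrite lt_neqAle k1 /= leNgt -k2 -leNgt; exact: ltW.
Qed.

End Shadowing.

(** * Topology of the torus and of the subshift *)

Section TorusTopology.
Variable R : realType.
Local Notation phi := (phi R).
Local Notation T0 := (torus (phi, 0) (1, phi + 3)).
Local Open Scope quotient_scope.

Lemma open_sup_close (e : R) (x : R * R) : open [set z | sup_close e z x].
Proof.
have -> : [set z | sup_close e z x] =
    [set z | `|z.1 - x.1| < e] `&` [set z | `|z.2 - x.2| < e] by [].
apply: openI.
  apply: (@open_comp _ _ (fun z : R * R => `|z.1 - x.1|) [set y | y < e]); last exact: open_lt.
  by move=> z _; apply: cvg_norm; apply: cvgB; [exact: cvg_fst|exact: cvg_cst].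
apply: (@open_comp _ _ (fun z : R * R => `|z.2 - x.2|) [set y | y < e]); last exact: open_lt.
by move=> z _; apply: cvg_norm; apply: cvgB; [exact: cvg_snd|exact: cvg_cst].
Qed.

Lemma close_refl (e : R) x : 0 < e -> sup_close e x x.
Proof. by move=> e0; rewrite /sup_close !subrr normr0. Qed.

Lemma nbhs_sup_close (x : R * R) (B : set (R * R)) : nbhs x B ->
  exists2 e : R, 0 < e & forall y, sup_close e y x -> B y.
Proof.
move=> /nbhs_ballP[e e0 he]; exists e => // y [h1 h2]; apply: he.
by split; rewrite /= /ball /= distrC.
Qed.

Lemma closure_pi (A : set T0) (x : R * R) : closure A (\pi_T0 x) <->
  forall e : R, 0 < e -> exists2 y, sup_close e y x & A (\pi_T0 y).
Proof.
split=> [cA e e0|h B /= hB].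
  pose O : set T0 := [set q | exists2 y, sup_close e y x & q = \pi_T0 y].
  have oO : open O.
    have -> : open O = open (\pi_T0 @^-1` O) by [].
    have -> : \pi_T0 @^-1` O = \bigcup_k [set z : R * R | sup_close e z (x + lattice R k)].
      apply/seteqP; split=> z /=.
        move=> [y hy /pi_eq[k ->]]; exists k => //.
        exact: close_add.
      move=> [k _ /= hz]; exists (z - lattice R k).
        by have := close_add (- lattice R k) hz; rewrite addrK.
      by apply/pi_eq; exists k; rewrite subrK.
    by apply: bigcup_open => k _; exact: open_sup_close.
  have [] := cA O; first by apply: open_nbhs_nbhs; split=> //; exists x => //; exact: close_refl.
  by move=> q [Aq [y hy qy]]; exists y; rewrite -?qy.
have := @pi_continuous _ (Quotient.quot (zspan (phi, 0) (1, phi + 3))) x _ hB.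
move=> /nbhs_sup_close[e e0 he]; have [y hy Ay] := h e e0.
by exists (\pi_T0 y); split=> //; exact: he.
Qed.

Lemma P0_lift (a : 'I_11) (x : R * R) : P0 a (\pi_T0 x) <-> lift_atom a x.
Proof. exact: P0_pi. Qed.

Lemma R0_lift n (x : R * R) : R0 n (\pi_T0 x) = \pi_T0 (x + intvec R n).
Proof. exact: R0_pi. Qed.

Lemma open_atom a : open [set x : R * R | in_atom a x].
Proof.
have -> : [set x : R * R | in_atom a x] = \bigcup_(Q in [set` pieces a]) [set x | sat Q x].
  apply/seteqP; split=> x /=; first by move=> /hasP[Q hQ hs]; exists Q.
  by move=> [Q hQ hs]; apply/hasP; exists Q.
by apply: bigcup_open => Q _; exact: open_sat.
Qed.

Lemma open_P0 (a : 'I_11) : open (P0 (R := R) a).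
Proof.
have -> : open (P0 (R := R) a) = open (\pi_T0 @^-1` (P0 a)) by [].
have -> : \pi_T0 @^-1` (P0 a) = \bigcup_k ((fun x : R * R => x - lattice R k) @^-1` [set x | in_atom a x]).
  apply/seteqP; split=> x /=; first by move/P0_pi => [k hk]; exists k.
  by move=> [k _ hk]; apply/P0_pi; exists k.
apply: bigcup_open => k _; apply: open_comp; last exact: open_atom.
by move=> x _; apply: cvgB; [exact: cvg_id|exact: cvg_cst].
Qed.

Lemma fundamental_box (x : R * R) : exists k,
  (0 <= (x - lattice R k).1 < phi) /\ (0 <= (x - lattice R k).2 < phi + 3).
Proof.
have p1 := phi_gt R; pose n2 := Num.floor (x.2 / (phi + 3)).
pose n1 := Num.floor ((x.1 - n2%:~R) / phi).
have p3 : 0 < phi + 3 by lra.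
have p0 : 0 < phi by lra.
exists (n1, n2); rewrite latticeE /=.
have /andP[a1 a2] := floor_itv (x.2 / (phi + 3)); rewrite -/n2 intrD in a1 a2.
have /andP[b1 b2] := floor_itv ((x.1 - n2%:~R) / phi); rewrite -/n1 intrD in b1 b2.
rewrite ler_pdivlMr// in a1; rewrite ltr_pdivrMr// in a2.
rewrite ler_pdivlMr// in b1; rewrite ltr_pdivrMr// in b2.
by split; lra.
Qed.

(** Each slack is a nonconstant affine function along the ray, so it has constant nonzero sign just
    after the origin. This makes a point a limit of points of a single piece. *)
Lemma generic_ray (L : seq constr) (x r : R * R) : (forall d, form d r != 0) ->
  exists2 t0 : R, 0 < t0 & forall h, h \in L -> exists b, forall t, 0 < t < t0 ->
    slack h (x.1 + t * r.1, x.2 + t * r.2) != 0 /\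
    (0 < slack h (x.1 + t * r.1, x.2 + t * r.2)) = b.
Proof.
move=> hr; elim: L => [|h L [t1 t10 h1]]; first by exists 1.
suff [t2 t20 [b h2]] : exists2 t2 : R, 0 < t2 & exists b, forall t, 0 < t < t2 ->
    slack h (x.1 + t * r.1, x.2 + t * r.2) != 0 /\
    (0 < slack h (x.1 + t * r.1, x.2 + t * r.2)) = b.
  exists (Num.min t1 t2); first by rewrite lt_min t10.
  move=> g; rewrite in_cons => /orP[/eqP ->|/h1[b' hb']].
    by exists b => t; rewrite lt_min => /and3P[q0 _ q2]; apply: h2; rewrite q0.
  by exists b' => t; rewrite lt_min => /and3P[q0 q1 _]; apply: hb'; rewrite q0.
have [k k0 hk] : exists2 k : R, k != 0 &
    forall t, slack h (x.1 + t * r.1, x.2 + t * r.2) = slack h x + t * k.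
  have := hr h.1.1; rewrite /slack; case: h.1.2 => h0.
    by exists (form h.1.1 r) => // t; rewrite form_comb; ring.
  by exists (- form h.1.1 r); rewrite ?oppr_eq0// => t; rewrite form_comb; ring.
have kp : 0 < `|k| by rewrite normr_gt0.
have [hs|hs] := eqVneq (slack h x) 0.
  exists 1 => //; exists (0 < k) => t /andP[q0 _].
  by rewrite hk hs add0r (mulf_neq0 (lt0r_neq0 q0) k0) (pmulr_rgt0 _ q0).
exists (`|slack h x| / `|k|); first by rewrite divr_gt0 ?normr_gt0.
exists (0 < slack h x) => t /andP[q0]; rewrite (ltr_pdivlMr _ _ kp) hk => q1.
have {q1} : `|t * k| < `|slack h x| by rewrite normrM gtr0_norm.
rewrite ltr_norml; have [s0|s0|/eqP] := ltrgt0P (slack h x); last by rewrite (negbTE hs).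
  by move=> q1; split; [rewrite gt_eqF//; lra|apply/idP; lra].
by move=> q1; split; [rewrite lt_eqF//; lra|apply/negbTE; rewrite -leNgt; lra].
Qed.

(** For the covering, start at a point of the fundamental box and follow the direction (1, 1), on
    which no form vanishes. The initial part of the ray lies in one piece, which [coversP] finds. *)
Lemma P0_partition : topological_partition (@P0 R).
Proof.
split; first exact: open_P0.
  move=> a b nab; apply/seteqP; split=> // p [].
  have [x ->] := pi_surj p; move=> /P0_lift ha /P0_lift hb.
  by move/eqP: nab; apply; apply/val_inj; exact: lift_atom_uniq ha hb.
apply/seteqP; split=> // p _; have [x ->] := pi_surj p.
have p1 := phi_gt R; have pp := phi2 R.
have [k] := fundamental_box x; move yE : (x - lattice R k) => y [k1 k2].
have hr d : form d ((1, 1) : R * R) != 0.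
  by case: d => /=; rewrite ?mulr1 ?pp ?oner_eq0//; apply/eqP; lra.
have [t0 t00 ht] := generic_ray (flatten all_pieces) y hr.
(* The bounds phi - y.1 and phi + 3 - y.2 keep the ray inside the open box. *)
pose t1 := Num.min t0 (Num.min (phi - y.1) (phi + 3 - y.2)).
have t10 : 0 < t1 by rewrite !lt_min t00; apply/andP; split; lra.
have [q0 [q1 q2]] : t1 <= t0 /\ t1 <= phi - y.1 /\ t1 <= phi + 3 - y.2.
  have : t1 <= t1 by []. 
  by rewrite {2}/t1 !le_min => /and3P[].
pose z t : R * R := (y.1 + t * 1, y.2 + t * 1).
have hcov : has (fun Q => sat Q (z (t1 / 2))) all_pieces.
  apply: (coversP pieces_cover).
    rewrite /sat /= /slack /gval /= /z; apply/and5P; split=> //; lra.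
  move=> Q hQ h hh; have hL : h \in flatten all_pieces by apply/flattenP; exists Q.
  have [b hb] := ht h hL; have [] := hb (t1 / 2); last by [].
  by apply/andP; split; lra.
have [Q /flatten_mapP[a ha hQ] hs] := hasP hcov.
have ha' : (a < 11)%N by move: ha; rewrite mem_iota.
exists (Ordinal ha') => //; apply/closure_pi => e e0.
pose t := Num.min e t1 / 2.
have m0 : 0 < Num.min e t1 by rewrite lt_min e0.
have [m1 m2] : Num.min e t1 <= e /\ Num.min e t1 <= t1 by apply/andP; rewrite -le_min.
exists (x + (t, t)).
  by rewrite /sup_close /= !(addrAC _ t) !subrr !add0r gtr0_norm /t; lra.
apply/P0_lift; exists k; apply/hasP; exists Q => //.
have -> : x + (t, t) - lattice R k = z t.
  by rewrite /z !mulr1 addrAC yE.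
apply/allP => h hh; have hL : h \in flatten all_pieces.
  apply/flattenP; exists Q => //; apply/flatten_mapP; by exists a.
have [b hb] := ht h hL.
have [_ e1] := hb (t1 / 2) ltac:(apply/andP; split; lra).
have [_ e2] := hb t ltac:(rewrite /t; apply/andP; split; lra).
by rewrite /z e2 -e1; exact: (allP hs).
Qed.

End TorusTopology.

(** * Finite type and symbolic representation of the subshift *)

Section Symbolic.
Variable R : realType.
Local Notation phi := (phi R).
Local Notation T0 := (torus (phi, 0) (1, phi + 3)).
Local Notation P0_system := (symbolic_system (@P0 R) (@R0 R)).
Local Open Scope quotient_scope.

Definition int_range (N : nat) : seq int := [seq i%:Z - N%:Z | i <- iota 0 (N + N).+1].

Lemma mem_int_range N (i : int) : (`|i| <= N)%N -> i \in int_range N.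
Proof.
move=> hi; apply/mapP; exists `|(i + N%:Z)%R|%N; last lia.
by rewrite mem_iota; lia.
Qed.

Definition l1ball (N : nat) : seq Z2 :=
  [seq k <- [seq (i, j) | i <- int_range N, j <- int_range N] | (l1norm k <= N)%N].

Lemma mem_l1ball N k : (k \in l1ball N) = (l1norm k <= N)%N.
Proof.
rewrite mem_filter; apply: andb_idr => hk.
case: k hk => i j hk; have {hk} [hi hj] : (`|i| <= N)%N /\ (`|j| <= N)%N.
  by move: hk; rewrite /l1norm /=; lia.
apply/flatten_mapP; exists i; first exact: mem_int_range.
by apply/mapP; exists j => //; exact: mem_int_range.
Qed.

Lemma allowedP (x : config 'I_11) (S : {fset Z2}) :
  allowed (@P0 R) (@R0 R) (config_restrict x S) <->
  exists p : R * R, forall k, k \in S -> lift_atom (x k : 'I_11) (p + intvec R k).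
Proof.
split=> [[q hq]|[p hp]].
  have [p hp] := pi_surj q; exists p => k kS.
  have := hq [` kS]%fset I; rewrite /= ffunE /= hp R0_lift; exact: (P0_lift _ _).1.
exists (\pi_T0 p) => k _; rewrite /= ffunE R0_lift; apply/P0_lift.
exact: hp (valP k).
Qed.

Lemma P0_systemP (w : config 'I_11) : P0_system w <->
  forall S : seq Z2, exists p : R * R, forall j, j \in S -> lift_atom (w j : 'I_11) (p + intvec R j).
Proof.
have nvD n m : intvec R (n + m) = intvec R n + intvec R m by rewrite /intvec /= !intrD.
split=> [h S|h n S].
  have /allowedP[p hp] := h 0 [fset k in S]%fset.
  by exists p => j jS; have := hp j; rewrite !inE jS => /(_ isT); rewrite /config_shift addr0.
have [p hp] := h [seq k + n | k <- S]; apply/allowedP; exists (p + intvec R n) => k kS.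
rewrite -addrA [intvec R n + _]addrC -nvD; apply: hp.
by apply/mapP; exists k.
Qed.

Lemma config_shiftD n m (w : config 'I_11) :
  config_shift n (config_shift m w) = config_shift (n + m) w.
Proof. by apply/funext => k; rewrite /config_shift addrA. Qed.

Lemma P0_system_shift n (w : config 'I_11) : P0_system w -> P0_system (config_shift n w).
Proof. by move=> h m S; rewrite config_shiftD; exact: h. Qed.

Lemma P0_system_closed : closed P0_system.
Proof.
move=> w cw; apply/P0_systemP => S.
have nS : nbhs w [set y : config 'I_11 | forall j, j \in S -> y j = w j].
  elim: S => [|j S IH]; first by apply: filterS filterT.
  have hj : nbhs w [set y : config 'I_11 | y j = w j].
    apply: (@proj_continuous _ (fun=> discrete_topology 'I_11) j w [set w j]).
    exact: discrete_set1.
  apply: filterS (filterI hj IH) => y [h1 h2] i.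
  by rewrite in_cons => /orP[/eqP ->|/h2].
have [y [/P0_systemP Xy hy]] := cw _ nS; have [p hp] := Xy S.
by exists p => j jS; rewrite -(hy j jS); exact: hp.
Qed.

(** The forbidden patterns are the disallowed ones whose domain is exactly the ball of the shadowing
    radius; there are finitely many, and [shadowing] shows that avoiding them suffices. *)
Lemma P0_system_SFT : is_SFT P0_system.
Proof.
split; first by split; [exact: P0_system_closed | exact: P0_system_shift].
have [N hN] := shadowing R; pose B : {fset Z2} := [fset k in l1ball N]%fset.
have mB k : (k \in B) = (l1norm k <= N)%N by rewrite !inE mem_l1ball.
pose F := [set g : pattern 'I_11 | domf g = B /\ ~ allowed (@P0 R) (@R0 R) g].
exists F.
  apply: (@sub_finite_set _ _ ((fun h : {ffun B -> 'I_11} => FinMap h) @` setT)).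
    by move=> [D h] [/= gB _]; move: h; rewrite gB => h; exists h.
  by apply: finite_image; exact: finite_finset.
apply/seteqP; split=> w; first by move=> h n S [_]; apply; exact: h.
move=> h; apply/P0_systemP => S.
apply: (hN (fun k => (w k : 'I_11) : nat)) => n.
have : allowed (@P0 R) (@R0 R) (config_restrict (config_shift n w) B).
  by apply: contrapT => na; apply: (h n B).
move=> /allowedP[p hp]; exists p => k hk; apply: hp.
by rewrite mB.
Qed.

Lemma lift_atom_shift a (x : R * R) k n : lift_atom a (x + intvec R n) ->
  lift_atom a (x - lattice R k + intvec R n).
Proof. by rewrite addrAC -latticeN; exact: lift_atom_lattice. Qed.

Lemma D_cellP n (w : config 'I_11) (x : R * R) : D_cell (@P0 R) (@R0 R) n w (\pi_T0 x) <->
  forall k, (l1norm k <= n)%N -> lift_atom (w k : 'I_11) (x + intvec R k).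
Proof.
split=> h k hk; have := h k hk; first by rewrite /= R0_lift; exact: (P0_lift _ _).1.
by rewrite /= R0_lift; exact: (P0_lift _ _).2.
Qed.

Lemma box_cluster (x : nat -> R * R) :
  (forall n, (0 <= (x n).1 < phi) /\ (0 <= (x n).2 < phi + 3)) ->
  exists y : R * R, forall (e : R) N, 0 < e -> exists2 m, (N <= m)%N & sup_close e (x m) y.
Proof.
move=> hx; have cK : compact (`[0, phi] `*` `[0, phi + 3] : set (R * R)).
  by apply: compact_setX; exact: segment_compact.
have FK : (x @ \oo) (`[0, phi] `*` `[0, phi + 3] : set (R * R)).
  exists 0%N => // n _; have [h1 h2] := hx n.
  by split; rewrite /= in_itv /=; lra.
have [y [_ hy]] := cK (x @ \oo) _ FK; exists y => e N e0.
have hN : (x @ \oo) (x @` [set m | (N <= m)%N]).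
  by exists N => // n hn; exists n.
have hb : nbhs y [set z | sup_close e z y].
  by apply: open_nbhs_nbhs; split; [exact: open_sup_close | exact: close_refl].
by have [_ [[m hm <-] hc]] := hy _ _ hN hb; exists m.
Qed.

(** Existence: a cluster point of points realizing larger and larger windows lies in all the
    closures. Uniqueness: two such points are limits of points with equal codings on large windows,
    so [closeness] applies at every scale. *)
Lemma P0_symbolic_representation : symbolic_representation (@P0 R) (@R0 R).
Proof.
move=> w /P0_systemP hw.
have /choice[x hx] : forall n : nat, exists x : R * R,
    ((0 <= x.1 < phi) /\ (0 <= x.2 < phi + 3)) /\
    forall k, (l1norm k <= n)%N -> lift_atom (w k : 'I_11) (x + intvec R k).
  move=> n; have [p hp] := hw (l1ball n); have [k hk] := fundamental_box p.
  exists (p - lattice R k); split=> // j hj; apply: lift_atom_shift; apply: hp.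
  by rewrite mem_l1ball.
have [y hy] := box_cluster (fun n => (hx n).1).
have mem : (\bigcap_n closure (D_cell (@P0 R) (@R0 R) n w)) (\pi_T0 y).
  move=> n _; apply/closure_pi => e e0; have [m hm hc] := hy e n e0.
  exists (x m) => //; apply/D_cellP => k hk; apply: (hx m).2.
  exact: leq_trans hm.
exists (\pi_T0 y); apply/seteqP; split=> [q hq|_ -> //].
have [z hz] := pi_surj q; rewrite hz in hq *.
have near (e : R) : 0 < e -> exists g, sup_close (e + (e + e)) z (y + lattice R g).
  move=> e0; have [N hN] := closeness e0.
  have [y' hy' /D_cellP cy] := (closure_pi _ _).1 (mem N I) e e0.
  have [z' hz' /D_cellP cz] := (closure_pi _ _).1 (hq N I) e e0.
  have [|g hg] := hN y' z'.
    by move=> k hk; exists (w k : 'I_11); [exact: cy|exact: cz].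
  exists g; apply: close_trans (close_sym hz') _; apply: close_trans hg _.
  exact: close_add.
have e1 : 0 < 1 / 12 :> R by lra.
have [g hg] := near _ e1; apply/pi_eq; exists g.
(* The lattice vector from [near] depends on the scale; below scale 1/12 the error is under 1/4, so
   [close_lattice_uniq] identifies it with the fixed g. *)
have small (e : R) : 0 < e -> sup_close e z (y + lattice R g).
  move=> e0; pose d := Num.min (e / 3) (1 / 12).
  have d0 : 0 < d by rewrite lt_min; lra.
  have [d1 d2] : d <= e / 3 /\ d <= 1 / 12 by apply/andP; rewrite -le_min.
  have [g' [c1 c2]] := near d d0.
  have {c1 c2} hd : sup_close (1 / 4) z (y + lattice R g') /\ sup_close e z (y + lattice R g').
    by split; split; first [apply: lt_le_trans c1 _ | apply: lt_le_trans c2 _]; lra.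
  have hg4 : sup_close (1 / 4) z (y + lattice R g).
    by case: hg => k1 k2; split; first [apply: lt_le_trans k1 _ | apply: lt_le_trans k2 _]; lra.
  have e4 : 1 / 4 <= 1 / 2 :> R by lra.
  by rewrite (close_lattice_uniq e4 hg4 hd.1); exact: hd.2.
have zero (a b : R) : (forall e, 0 < e -> `|a - b| < e) -> a = b.
  move=> h; apply/subr0_eq/eqP; rewrite -normr_le0 leNgt; apply/negP => h0.
  by have := h _ h0; rewrite ltxx.
rewrite [z]surjective_pairing [RHS]surjective_pairing.
by congr pair; apply: zero => e /small[].
Qed.

End Symbolic.

Theorem theorem1p1 (R : realType) : Markov_partition (@P0 R) (@R0 R).
Proof.
by split; [exact: P0_partition | exact: P0_symbolic_representation | exact: P0_system_SFT].
Qed.
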